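(* Let $\mathbb{A}$ be a unital $C^*$-algebra, $\Omega$ its open cone of positive invertible elements, and $H$ its space of hermitian elements. The function $K:\Omega\times\mathcal{P}^1(\Omega)\to H$ defined by the Bochner integral $$K(x,\mu)=\int_\Omega\log(x^{-1/2}ax^{-1/2})\,d\mu(a)$$ is continuous.
   Context: $H$ carries the $C^*$-norm. $x\le y$ in $H$ means $y-x$ is positive (in $\overline\Omega$). $\Omega$ carries the Thompson metric $d(x,y)=\log\max\{M(x/y),M(y/x)\}$, $M(x/y)=\inf\{t>0: x\le ty\}$; it is complete and induces the norm topology on $\Omega$. For a metric space $(X,d)$: the support of a Borel measure is the set of points all of whose open neighbourhoods have positive measure. $\mathcal{P}(X)$ is the set of Borel probability measures on $X$ whose support has measure $1$; $\mathcal{P}^1(X)$ is the set of $\mu\in\mathcal{P}(X)$ with $\int_X d(x,y)\,d\mu(x)<\infty$ for some (hence all) $y\in X$. The Wasserstein distance on $\mathcal{P}^1(X)$ is $d_w(\mu,\nu)=\inf_{\pi\in\Pi(\mu,\nu)}\int_{X\times X}d(x,y)\,d\pi(x,y)$, where $\Pi(\mu,\nu)\subseteq\mathcal{P}(X\times X)$ is the set of couplings (measures with marginals $\mu$ and $\nu$). $\mathcal{P}^1(\Omega)$ is taken with respect to the Thompson metric and has the topology of the corresponding $d_w$; $\Omega\times\mathcal{P}^1(\Omega)$ has the product topology. *)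

(* Defs.v *)
From HB Require Import structures.
From mathcomp Require Import all_boot all_order all_algebra.
From mathcomp Require Import complex.
From mathcomp Require Import all_classical all_reals all_analysis.

Set Implicit Arguments.
Unset Strict Implicit.
Unset Printing Implicit Defensive.

Import Order.TTheory GRing.Theory Num.Theory.
Import numFieldNormedType.Exports.

Local Open Scope classical_set_scope.
Local Open Scope ring_scope.

(* Unital C*-algebras over C = R[i].
   - Asking for a [unitAlgType] rather than an [algType] is no restriction: in
     any ring the set of units and the inverse exist classically, and they are
     determined by the multiplication.
   - The norm is a field of its own, real-valued: the library's norm on a
     module over R[i] takes its values in R[i], and a structure joining the
     library's rings and normed modules does not exist.
   - [cnorm_complete] says that Cauchy sequences converge. *)
HB.mixin Record isCStarAlgebra (R : realType) A & GRing.UnitAlgebra R[i] A := {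
  star : A -> A ;
  starK : involutive star ;
  starD : {morph star : x y / x + y} ;
  starM : forall x y : A, star (x * y) = star y * star x ;
  starZ : forall (z : R[i]) (x : A), star (z *: x) = conjc z *: star x ;
  cnorm : A -> R ;
  cnorm_eq0 : forall x : A, cnorm x = 0 -> x = 0 ;
  cnormD : forall x y : A, cnorm (x + y) <= cnorm x + cnorm y ;
  cnormZ : forall (z : R[i]) (x : A), cnorm (z *: x) = complex.Re `|z| * cnorm x ;
  cnormM : forall x y : A, cnorm (x * y) <= cnorm x * cnorm y ;
  cnorm_star : forall x : A, cnorm (star x * x) = cnorm x ^+ 2 ;
  cnorm_complete : forall u : nat -> A,
    (forall e : R, 0 < e -> exists N : nat, forall m n : nat,
      (N <= m)%N -> (N <= n)%N -> cnorm (u m - u n) < e) ->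
    exists l : A, forall e : R, 0 < e -> exists N : nat, forall n : nat,
      (N <= n)%N -> cnorm (u n - l) < e
}.

#[short(type="cstarAlgType")]
HB.structure Definition CStarAlgebra (R : realType) :=
  {A of GRing.UnitAlgebra R[i] A & isCStarAlgebra R A}.

Section Hermitian.
Context {R : realType} (A : cstarAlgType R).

Definition is_herm : {pred A} := fun x => star x == x.

Let star0 : star (0 : A) = 0.
Proof. by apply: (@addrI _ (star 0)); rewrite -starD !addr0. Qed.

Let starN (x : A) : star (- x) = - star x.
Proof. by apply/eqP; rewrite -addr_eq0 -starD addNr star0. Qed.

Lemma is_herm_zmod : zmod_closed is_herm.
Proof.
split=> [|x y /eqP hx /eqP hy]; first by rewrite unfold_in star0.
by rewrite unfold_in starD starN hx hy.
Qed.
HB.instance Definition _ := GRing.isZmodClosed.Build A is_herm is_herm_zmod.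

Record herm := Herm { herm_val :> A ; herm_valP : herm_val \in is_herm }.
HB.instance Definition _ := [isSub for herm_val].
HB.instance Definition _ := [Choice of herm by <:].
HB.instance Definition _ := [SubChoice_isSubZmodule of herm by <:].

Lemma herm_scale_subproof (t : R) (a : herm) : (t%:C)%C *: (a : A) \in is_herm.
Proof.
by rewrite unfold_in starZ (eqP (herm_valP a)) /= oppr0.
Qed.

Definition herm_scale (t : R) (a : herm) : herm := Herm (herm_scale_subproof t a).

Let herm_scaleA s t a : herm_scale s (herm_scale t a) = herm_scale (s * t) a.
Proof. by apply: val_inj; rewrite /= scalerA rmorphM. Qed.

Let herm_scale1 : left_id 1 herm_scale.
Proof. by move=> a; apply: val_inj; rewrite /= scale1r. Qed.

Let herm_scaleDr : right_distributive herm_scale +%R.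
Proof. by move=> t a b; apply: val_inj; rewrite /= scalerDr. Qed.

Let herm_scaleDl a : {morph herm_scale^~ a : s t / s + t}.
Proof. by move=> s t; apply: val_inj; rewrite /= rmorphD scalerDl. Qed.

HB.instance Definition _ := GRing.Zmodule_isLmodule.Build R herm
  herm_scaleA herm_scale1 herm_scaleDr herm_scaleDl.

Let hnorm (a : herm) : R := cnorm (a : A).

Let hnormD a b : hnorm (a + b) <= hnorm a + hnorm b.
Proof. exact: cnormD. Qed.

Let hnormZ (t : R) a : hnorm (t *: a) = `|t| * hnorm a.
Proof.
by rewrite /hnorm cnormZ /= expr0n /= addr0 sqrtr_sqr.
Qed.

Let hnorm0_eq0 a : hnorm a = 0 -> a = 0.
Proof. by move=> /cnorm_eq0 a0; apply: val_inj. Qed.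

HB.instance Definition _ := Lmodule_isNormed.Build R herm
  hnormD hnormZ hnorm0_eq0.

End Hermitian.
Arguments is_herm {R} A x : rename.

Section FunctionalCalculus.
Context {R : realType} {A : cstarAlgType R}.

Definition spectrum (x : A) : set R[i] :=
  [set z | z%:A - x \isn't a GRing.unit].

Definition real_spectrum (a : herm A) : set R :=
  [set t | spectrum a (t%:C)%C].

(* Continuous functional calculus of a hermitian element: [f a] is the limit of
   [p_n a] for any polynomials [p_n] converging to [f] uniformly on the
   spectrum of [a].  The [p_n] may be taken real since this spectrum is real. *)
Definition is_cfc (f : R -> R) (a y : herm A) : Prop :=
  exists p : nat -> {poly R},
    {uniform real_spectrum a, (fun n t => (p n).[t]) @ \oo --> f} /\
    cnorm (horner_alg (a : A) (map_poly (real_complex R) (p n)) - (y : A))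
      @[n --> \oo] --> (0 : R).

Definition cfc (f : R -> R) (a : herm A) : herm A := xget 0 (is_cfc f a).

Lemma sandwich_subproof (c a : herm A) : (c : A) * (a : A) * (c : A) \in is_herm A.
Proof.
have E (b : herm A) : star (b : A) = b by exact: eqP (herm_valP b).
by rewrite unfold_in !starM !E mulrA.
Qed.

Definition sandwich (c a : herm A) : herm A := Herm (sandwich_subproof c a).

(* Order of R[i]: [0 <= z] means that [z] is real and nonnegative. *)
Definition positive (a : herm A) : Prop :=
  forall z : R[i], spectrum a z -> 0 <= z.

Definition herm_le (a b : herm A) : Prop := positive (b - a).

End FunctionalCalculus.

Section Cone.
Context {R : realType} (A : cstarAlgType R).

Definition is_posinv : {pred herm A} :=
  fun a => `[< positive a >] && ((a : A) \is a GRing.unit).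

Record cone := Cone { cone_val :> herm A ; cone_valP : cone_val \in is_posinv }.
HB.instance Definition _ := [isSub for cone_val].
HB.instance Definition _ := [Choice of cone by <:].

Let herm1_subproof : (1 : A) \in is_herm A.
Proof.
have : star (star 1 * 1) = star (1 : A) * 1 by rewrite starM starK.
by rewrite mulr1 starK => h1; rewrite unfold_in -h1.
Qed.

Let cone1_subproof : Herm herm1_subproof \in is_posinv.
Proof.
rewrite unfold_in unitr1 andbT; apply/asboolP => z /negP.
rewrite /= -[X in _ - X]scale1r -scalerBl => nu.
have [->//|z1] := eqVneq z 1; exfalso; apply: nu.
by rewrite scaler_unit ?unitr1// unitfE subr_eq0.
Qed.

(* Measurable spaces are required to be pointed by the library. *)
HB.instance Definition _ := isPointed.Build cone (Cone cone1_subproof).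

(* The number usually written [M(x/y)]. *)
Definition gauge (x y : cone) : R :=
  inf [set t : R | 0 < t /\ herm_le x (t *: (y : herm A))].

Definition thompson (x y : cone) : \bar R :=
  (ln (Num.max (gauge x y) (gauge y x)))%:E.

End Cone.
Arguments thompson {R} A x y.

(* A copy of [X] carrying the topology of the open balls of [d].  Distances are
   extended-real valued because the Wasserstein distance is defined as an
   infimum of integrals of nonnegative functions. *)
Definition metrized {R : realType} {X : Type} (d : X -> X -> \bar R) : Type := X.

Section Metrized.
Context {R : realType} (X : choiceType) (d : X -> X -> \bar R).

Definition ball_open_set : set (set (metrized d)) :=
  [set U | forall x, U x ->
     exists2 e : R, 0 < e & forall y, (d x y < e%:E)%E -> U y].

Let openT : ball_open_set setT.
Proof. by move=> x _; exists 1. Qed.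

Let openI : setI_closed ball_open_set.
Proof.
move=> U V oU oV x [/oU[e e0 eU] /oV[f f0 fV]].
exists (Num.min e f) => [|y]; first by rewrite lt_min e0.
by rewrite EFin_min lt_min => /andP[/eU Uy /fV Vy].
Qed.

Let open_bigU (I : Type) (U : I -> set (metrized d)) :
  (forall i, ball_open_set (U i)) -> ball_open_set (\bigcup_i U i).
Proof.
move=> oU x [i _ /oU[e e0 eU]]; exists e => // y /eU Uiy.
by exists i.
Qed.

HB.instance Definition _ := Choice.on (metrized d).
HB.instance Definition _ :=
  isOpenTopological.Build (metrized d) openT openI open_bigU.

End Metrized.

HB.instance Definition _ (R : realType) (X : pointedType) (d : X -> X -> \bar R) :=
  Pointed.on (metrized d).

HB.instance Definition _ (X Y : ptopologicalType) :=
  Pointed.on (X * Y)%type.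

Section BorelProbabilities.
Context {R : realType}.

Definition borel (X : ptopologicalType) := g_sigma_algebraType (@open X).

Definition msupport (X : ptopologicalType) (mu : probability (borel X) R) :
    set X :=
  [set x | forall U : set X, open_nbhs x U -> (0 < mu U)%E].

Definition full_support (X : ptopologicalType) (mu : probability (borel X) R) :=
  mu (msupport mu) = 1%E.

End BorelProbabilities.

Section Wasserstein.
Context {R : realType} (X : pointedType) (d : X -> X -> \bar R).

Definition is_prob1 : {pred probability (borel (metrized d)) R} :=
  fun mu => `[< full_support mu /\
    exists y : X, (\int[mu]_x d x y < +oo)%E >].

Record prob1 := Prob1 {
  prob1_val :> probability (borel (metrized d)) R ;
  prob1_valP : prob1_val \in is_prob1 }.
HB.instance Definition _ := [isSub for prob1_val].
HB.instance Definition _ := [Choice of prob1 by <:].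

(* Couplings live on the Borel sigma-algebra of the product topology, which is
   in general larger than the product of the Borel sigma-algebras. *)
Definition coupling (mu nu : prob1) :
    set (probability (borel (metrized d * metrized d)%type) R) :=
  [set pi | [/\ full_support pi,
    forall B : set (borel (metrized d)), measurable B ->
      pi (fst @^-1` B) = mu B &
    forall B : set (borel (metrized d)), measurable B ->
      pi (snd @^-1` B) = nu B]].

Definition wasserstein (mu nu : prob1) : \bar R :=
  ereal_inf [set (\int[pi]_z d z.1 z.2)%E | pi in coupling mu nu].

End Wasserstein.
Arguments wasserstein {R X} d mu nu.

Section Bochner.
Context {dsp : measure_display} {T : measurableType dsp} {R : realType}.
Context (mu : {finite_measure set T -> \bar R}) {V : normedModType R}.

Definition simple_fun (s : T -> V) : Prop :=
  finite_set (range s) /\ forall v, measurable (s @^-1` [set v]).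

Definition simple_integral (s : T -> V) : V :=
  \sum_(v \in range s) fine (mu (s @^-1` [set v])) *: v.

Definition bochner_approx (f : T -> V) (s : nat -> T -> V) : Prop :=
  [/\ forall n, simple_fun (s n),
      {ae mu, forall x, s n x @[n --> \oo] --> f x} &
      (\int[mu]_x `|f x - s n x|%:E)%E @[n --> \oo] --> 0%E].

Definition bochner_integrable (f : T -> V) : Prop :=
  exists s, bochner_approx f s.

Definition bochner_integral (f : T -> V) : V :=
  xget 0 [set I | exists2 s, bochner_approx f s &
                    simple_integral (s n) @[n --> \oo] --> I].

End Bochner.

Section KarcherMap.
Context {R : realType} {A : cstarAlgType R}.

Definition log_at (x a : cone A) : herm A :=
  cfc (@ln R) (sandwich (cfc (fun t => t `^ (- 2^-1)) x) a).

Definition karcher_map (x : cone A) (mu : prob1 (thompson A)) : herm A :=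
  bochner_integral mu (log_at x).

End KarcherMap.

(* Main.v *)
(* Inversion is antitone on positive invertible elements, so the Riemann sums of
   ln t = \int_0^1 (t - 1) / (1 + s (t - 1)) ds are operator monotone, hence so
   is the logarithm.  Therefore a <= e^r b <= e^(2 r) a implies
   |log a - log b| <= r: the map a |-> log (x^-1/2 a x^-1/2) is 1-Lipschitz for
   the Thompson metric and vanishes at x.  Since a measure with full support
   charges only a separable set, this gives Bochner integrability; integrating
   against couplings, K(x, .) is 1-Lipschitz for the Wasserstein distance,
   uniformly in x.  Continuity of K(., mu) follows by dominated convergence from
   the norm continuity of the functional calculus. *)
Require Import Defs.
From HB Require Import structures.
From mathcomp Require Import all_boot all_order all_algebra.
From mathcomp Require Import complex.
From mathcomp Require Import all_classical all_reals all_analysis.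
From mathcomp Require Import measurable_realfun.
From mathcomp Require Import ring lra zify.

Set Implicit Arguments.
Unset Strict Implicit.
Unset Printing Implicit Defensive.

Import Order.TTheory GRing.Theory Num.Theory.
Import numFieldNormedType.Exports.

Local Open Scope classical_set_scope.
Local Open Scope ring_scope.

(** * Norm, spectrum and positivity in a C-star algebra *)

Section CStarNorm.
Context {R : realType} {A : cstarAlgType R}.
Implicit Types (x y z : A) (s t : R).

(** The algebraic half rests on one fact: a hermitian element has a real spectral value whose
    modulus is its norm. It makes real polynomial calculus isometric on the spectrum, so that
    uniform limits define [f a], and it turns positivity into a norm inequality, so that positive
    elements can be added. The inequality between inverses comes from a factorisation, with
    invertibility of the shifts [x + t] as the working form of positivity. The analytic half is
    shaped by [herm A] being possibly nonseparable: only distances to a fixed vector are required to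
    be measurable, and the approximating simple functions are picked from a sequence that is dense
    in the essential range. The Bochner integral is a choice among limits; what is known of it is
    drawn from one estimate that compares two integrals, possibly over different measures, on a
    common space. *)

Definition rscalar (t : R) : A := (t%:C)%C%:A.
Local Notation rsc := rscalar.

Lemma rsc_is_additive : zmod_morphism rsc.
Proof. by move=> s t; rewrite /rscalar rmorphB scalerBl. Qed.
HB.instance Definition _ := GRing.isZmodMorphism.Build R A rscalar rsc_is_additive.
Lemma rsc_is_multiplicative : monoid_morphism rsc.
Proof.
split=> [|s t]; first by rewrite /rscalar rmorph1 scale1r.
by rewrite /rscalar rmorphM -scalerAl mul1r scalerA.
Qed.
HB.instance Definition _ :=
  GRing.isMonoidMorphism.Build R A rscalar rsc_is_multiplicative.

Lemma rsc_scale t x : (t%:C)%C *: x = rsc t * x.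
Proof. by rewrite /rscalar -scalerAl mul1r. Qed.

Lemma rscC t x : rsc t * x = x * rsc t.
Proof. by rewrite /rscalar -scalerAl -scalerAr mul1r mulr1. Qed.

Lemma star0 : star (0 : A) = 0.
Proof. by apply: (@addrI _ (star 0)); rewrite -starD !addr0. Qed.

Lemma starN x : star (- x) = - star x.
Proof. by apply/eqP; rewrite -addr_eq0 -starD addNr star0. Qed.

Lemma starB x y : star (x - y) = star x - star y.
Proof. by rewrite starD starN. Qed.

Lemma star1 : star (1 : A) = 1.
Proof.
have : star (star 1 * 1) = star (1 : A) * 1 by rewrite starM starK.
by rewrite mulr1 starK.
Qed.

Lemma star_rsc t : star (rsc t) = rsc t.
Proof. by rewrite /rscalar starZ star1 /= oppr0. Qed.

Lemma cnorm0 : cnorm (0 : A) = 0.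
Proof. by rewrite -(scale0r (0 : A)) cnormZ normr0 mul0r. Qed.

Lemma cnorm_rscM t x : cnorm (rsc t * x) = `|t| * cnorm x.
Proof. by rewrite -rsc_scale cnormZ /= expr0n /= addr0 sqrtr_sqr. Qed.

Lemma cnormN x : cnorm (- x) = cnorm x.
Proof. by rewrite -mulN1r -[1](rmorph1 rsc) -rmorphN cnorm_rscM normrN1 mul1r. Qed.

Lemma cnormB x y : cnorm (x - y) = cnorm (y - x).
Proof. by rewrite -cnormN opprB. Qed.

Lemma cnorm_ge0 x : 0 <= cnorm x.
Proof.
have := cnormD x (- x); rewrite subrr cnorm0 cnormN -mulr2n.
by rewrite pmulrn_lge0.
Qed.

Lemma cnorm_tri x y z : cnorm (x - z) <= cnorm (x - y) + cnorm (y - z).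
Proof. by rewrite (le_trans _ (cnormD _ _))// addrA subrK. Qed.

(** [|y|^2 = |star y * y| <= |star y| |y|]; cancelling [|y|] gives one inequality, and [star x] in
    place of [x] gives the other. *)
Lemma cnorm_star_eq x : cnorm (star x) = cnorm x.
Proof.
have le y : cnorm y <= cnorm (star y).
  have [->|y0] := eqVneq (cnorm y) 0; first exact: cnorm_ge0.
  rewrite -(@ler_pM2r _ (cnorm y)) ?lt_def ?y0 ?cnorm_ge0//.
  by rewrite -expr2 -cnorm_star cnormM.
by apply/eqP; rewrite eq_le le andbT -{2}(starK x) le.
Qed.

Lemma cnorm1 : cnorm (1 : A) = 1.
Proof.
have n0 : cnorm (1 : A) != 0.
  by apply/eqP => /cnorm_eq0/eqP; rewrite oner_eq0.
apply: (mulIf n0); rewrite mul1r -expr2 -cnorm_star star1 mulr1//.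
Qed.

Lemma cnorm_rsc t : cnorm (rsc t) = `|t|.
Proof. by rewrite -[rsc t]mulr1 cnorm_rscM cnorm1 mulr1. Qed.

Lemma cnormX_le x n : cnorm (x ^+ n) <= cnorm x ^+ n.
Proof.
elim: n => [|n IH]; first by rewrite !expr0 cnorm1.
by rewrite !exprS (le_trans (cnormM _ _))// ler_wpM2l ?cnorm_ge0.
Qed.

Lemma cnorm_small x : (forall e, 0 < e -> cnorm x <= e) -> x = 0.
Proof.
move=> xe; apply: cnorm_eq0; apply/eqP; rewrite eq_le cnorm_ge0 andbT.
by apply/ler_addgt0Pl => e e0; rewrite addr0 xe.
Qed.

Lemma geometric_lt (q e C : R) : 0 <= q < 1 -> 0 < e ->
  exists N : nat, forall n, (N <= n)%N -> C * q ^+ n < e.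
Proof.
move=> /andP[q0 q1] e0.
have := @cvg_geometric R C q; rewrite ger0_norm// => /(_ q1).
move/cvgrPdist_lt => /(_ _ e0)[N _ NP]; exists N => n /NP /=.
rewrite sub0r normrN; exact: le_lt_trans (ler_norm _).
Qed.

(** Neumann series: the partial sums [S n] are Cauchy, with tails at most [q^n / (1 - q)], and
    completeness supplies the inverse as their limit. *)
Lemma one_sub_unit x : cnorm x < 1 -> 1 - x \is a GRing.unit.
Proof.
move=> x1; set q := cnorm x in x1.
have q0 : 0 <= q by exact: cnorm_ge0.
pose S n := \sum_(i < n) x ^+ i.
have SE n : (1 - x) * S n = 1 - x ^+ n.
  by rewrite -[RHS]opprB subrX1 -mulNr opprB.
have SE' n : S n * (1 - x) = 1 - x ^+ n.
  rewrite -SE /S mulr_sumr mulr_suml; apply: eq_bigr => i _.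
  by rewrite mulrBl mulrBr mul1r mulr1 -exprS -exprSr.
have q1 : 0 < 1 - q by rewrite subr_gt0.
have Sk k : cnorm (S k) * (1 - q) <= 1.
  rewrite (@le_trans _ _ (1 - q ^+ k)) ?gerBl ?exprn_ge0//.
  have -> : 1 - q ^+ k = (\sum_(i < k) q ^+ i) * (1 - q).
    by rewrite mulrC -[LHS]opprB subrX1 -mulNr opprB.
  rewrite ler_pM2r// /S.
  elim: (k) => [|m IH]; first by rewrite !big_ord0 cnorm0.
  rewrite !big_ord_recr /= (le_trans (cnormD _ _))// lerD//.
  exact: cnormX_le.
have Sd n k : cnorm (S (n + k)%N - S n) <= (1 - q)^-1 * q ^+ n.
  have -> : S (n + k)%N - S n = x ^+ n * S k.
    rewrite /S big_split_ord /= addrAC subrr add0r mulr_sumr.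
    by apply: eq_bigr => i _; rewrite exprD.
  rewrite (le_trans (cnormM _ _))// mulrC ler_pM ?cnorm_ge0 ?cnormX_le//.
  by rewrite -[_^-1]mul1r ler_pdivlMr.
have [l Sl] : exists l, forall e : R, 0 < e -> exists N : nat, forall n : nat,
    (N <= n)%N -> cnorm (S n - l) < e.
  apply: cnorm_complete => e e0.
  have e20 : 0 < e / 2 by rewrite divr_gt0.
  have [|N NP] := @geometric_lt q (e / 2) (1 - q)^-1 _ e20; first by rewrite q0.
  exists N => m n Nm Nn; rewrite (splitr e).
  have {Nm} := subnKC Nm; have {Nn} := subnKC Nn => <- <-.
  rewrite (le_lt_trans (cnorm_tri _ (S N) _))// [X in _ + X]cnormB.
  by rewrite ltrD// (le_lt_trans (Sd _ _))// NP.
(* Both one-sided inverse identities are limits of [z * S n * w], with [w = 1 - x] for one and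
   [z = 1 - x] for the other. *)
have lim y z w : (forall n, cnorm (z * S n * w - y) <= q ^+ n) ->
    z * l * w = y.
  move=> zw; apply/eqP; rewrite -subr_eq0; apply/eqP/cnorm_small => e e0.
  have e20 : 0 < e / 2 by rewrite divr_gt0.
  have [|N NP] := @geometric_lt q (e / 2) 1 _ e20; first by rewrite q0.
  pose C := cnorm z * cnorm w + 1.
  have C0 : 0 < C by rewrite ltr_wpDl ?mulr_ge0 ?cnorm_ge0.
  have [|N' NP'] := Sl (e / 2 / C); first by rewrite divr_gt0.
  pose n := maxn N N'; rewrite (le_trans (cnorm_tri _ (z * S n * w) _))//.
  rewrite [e]splitr lerD//; last first.
    by rewrite (le_trans (zw _))// -[leLHS]mul1r ltW// NP// leq_maxl.
  rewrite -mulrBl -mulrBr (le_trans (cnormM _ _))//.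
  rewrite (le_trans (ler_wpM2r _ (cnormM _ _))) ?cnorm_ge0// mulrAC.
  have /ltW := NP' n (leq_maxr _ _); rewrite cnormB ler_pdivlMr// mulrC.
  by apply: le_trans; rewrite ler_wpM2r ?cnorm_ge0// lerDl.
apply/unitrP; exists l; split.
  rewrite -[l]mul1r; apply: lim => n; rewrite mul1r SE' addrAC subrr sub0r cnormN.
  exact: cnormX_le.
rewrite -[LHS]mulr1; apply: lim => n; rewrite mulr1 SE addrAC subrr sub0r cnormN.
exact: cnormX_le.
Qed.
End CStarNorm.

Section Spectrum.
Context {R : realType} {A : cstarAlgType R}.
Implicit Types (x y z h : A) (s t : R).
Local Notation rsc := (@rscalar R A).

Lemma unit_perturb x y : x \is a GRing.unit -> cnorm (x - y) * cnorm x^-1 < 1 ->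
  y \is a GRing.unit.
Proof.
move=> xu xy; have -> : y = x * (1 - x^-1 * (x - y)).
  by rewrite mulrBr mulr1 mulrA divrr// mul1r opprB addrC subrK.
rewrite unitrMl ?one_sub_unit//.
by rewrite (le_lt_trans (cnormM _ _))// mulrC.
Qed.

Lemma rsc_unit t : t != 0 -> rsc t \is a GRing.unit.
Proof. by move=> t0; rewrite rmorph_unit// unitfE. Qed.

Lemma scalar_sub_unit (z : R[i]) x : cnorm x < complex.Re `|z| ->
  z%:A - x \is a GRing.unit.
Proof.
move=> xz; have z0 : z != 0.
  by apply: contraTneq xz => ->; rewrite normr0 /= -leNgt cnorm_ge0.
have -> : z%:A - x = z *: (1 - z^-1 *: x).
  by rewrite scalerBr scalerA divff// scale1r.
rewrite scaler_unit ?unitfE// one_sub_unit// cnormZ normfV.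
have -> : complex.Re `|z|^-1 = (complex.Re `|z|)^-1.
  rewrite normc_def /=; set r := Num.sqrt _.
  rewrite expr0n /= addr0; have [->|r0] := eqVneq r 0; first by rewrite !mul0r invr0.
  by field.
by rewrite mulrC ltr_pdivrMr ?mul1r// (le_lt_trans _ xz)// cnorm_ge0.
Qed.

Lemma spectrum_le (z : R[i]) x : spectrum x z -> complex.Re `|z| <= cnorm x.
Proof.
by move=> /negP; apply: contra_notT; rewrite -ltNge; exact: scalar_sub_unit.
Qed.

Let iA : A := ('i%C)%:A.
Let iAC x : iA * x = x * iA.
Proof. by rewrite /iA -scalerAl -scalerAr mul1r mulr1. Qed.
Let iA2 : iA * iA = -1.
Proof. by rewrite /iA -scalerAl mul1r scalerA -expr2 sqr_i scaleN1r. Qed.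
Let star_iA : star iA = - iA.
Proof.
rewrite /iA starZ star1 -scaleNr; congr (_ *: _).
by apply/eqP; rewrite eq_complex /= oppr0 !eqxx.
Qed.

Let complexA (a b : R) : (a +i* b)%C%:A = rsc a + iA * rsc b.
Proof.
rewrite /rscalar /iA -!scalerAl mul1r scalerA -scalerDl; congr (_ *: _).
by apply/eqP; rewrite eq_complex /= !(mul0r,mul1r,mulr0,subr0,addr0,add0r,eqxx).
Qed.

Lemma sub_sqr_comm x y : y * x = x * y -> (x - y) * (x + y) = x * x - y * y.
Proof. by move=> xy; rewrite mulrBl !mulrDr xy addrKA. Qed.

(* Shifting [h] by [i s] with [s] real moves a spectral value [a + i b] faster
   than the norm grows, since [|h + i s|^2 = |h^2 + s^2|]. *)
Lemma herm_nonreal_unit h (a b : R) : star h = h -> b != 0 ->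
  (a +i* b)%C%:A - h \is a GRing.unit.
Proof.
move=> hh b0; apply/negPn/negP => nu.
(* Chosen so that [2 b s = |h|^2 + 1]: comparing [a^2 + (b + s)^2] with [|h|^2 + s^2] then leaves
   [a^2 + b^2 + 1 <= 0]. *)
pose s := ((cnorm h ^+ 2 + 1) / (2 * b)).
have : complex.Re `|(a +i* (b + s))%C| <= cnorm (h + iA * rsc s).
  apply: spectrum_le; rewrite /spectrum /= complexA rmorphD mulrDr.
  by rewrite addrA [h + _]addrC addrKA -complexA; exact: nu.
rewrite normc_def /= => le.
have : a ^+ 2 + (b + s) ^+ 2 <= cnorm h ^+ 2 + s ^+ 2.
  have ge0 : 0 <= a ^+ 2 + (b + s) ^+ 2 by rewrite addr_ge0 ?sqr_ge0.
  rewrite -(sqr_sqrtr ge0).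
  have /le_trans -> // : Num.sqrt (a ^+ 2 + (b + s) ^+ 2) ^+ 2 <= cnorm (h + iA * rsc s) ^+ 2.
    by rewrite lerXn2r// nnegrE ?sqrtr_ge0 ?cnorm_ge0.
  rewrite -cnorm_star starD starM hh star_iA star_rsc.
  have -> : (h + rsc s * - iA) * (h + iA * rsc s) = h * h + rsc (s ^+ 2).
    rewrite mulrN rscC sub_sqr_comm; last by rewrite -mulrA rscC mulrA iAC -mulrA.
    rewrite mulrA -[iA * rsc s * iA]mulrA rscC mulrA iA2 -mulrA mulN1r opprK.
    by rewrite -rmorphM.
  rewrite (le_trans (cnormD _ _))// cnorm_rsc ger0_norm ?sqr_ge0// lerD2r.
  by rewrite expr2 cnormM.
rewrite sqrrD (_ : b * s *+ 2 = cnorm h ^+ 2 + 1); last first.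
  by rewrite /s; field.
have := sqr_ge0 a; have := sqr_ge0 b; lra.
Qed.

Lemma herm_spectrum_real h (z : R[i]) : star h = h -> spectrum h z ->
  z = (complex.Re z)%:C%C.
Proof.
case: z => a b hh; have [->//|b0] := eqVneq b 0.
by move=> /negP; rewrite herm_nonreal_unit.
Qed.

(** [1 + h^2] factors as [(i - h) (-i - h)], and neither [i] nor [-i] is a spectral value. *)
Lemma one_sqr_unit h : star h = h -> 1 + h ^+ 2 \is a GRing.unit.
Proof.
move=> hh; have -> : 1 + h ^+ 2 = ((0 +i* 1)%C%:A - h) * ((0 +i* -1)%C%:A - h).
  rewrite !complexA rmorph0 !add0r rmorphN !rmorph1 !mulr1 mulrN mulr1.
  rewrite -mulrNN !opprB opprK sub_sqr_comm ?iAC// iA2 opprK addrC expr2//.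
by rewrite unitrMl !herm_nonreal_unit ?oppr_eq0 ?oner_eq0.
Qed.

End Spectrum.

Section HermitianSpectrum.
Context {R : realType} {A : cstarAlgType R}.
Implicit Types (x y z h : A) (s t : R).
Local Notation rsc := (@rscalar R A).

Lemma starX x n : star (x ^+ n) = star x ^+ n.
Proof. by elim: n => [|n IH]; rewrite ?expr0 ?star1// exprS exprSr starM IH. Qed.

Lemma starV x : x \is a GRing.unit -> star x^-1 = (star x)^-1.
Proof.
move=> xu; have l : star x^-1 * star x = 1 by rewrite -starM divrr// star1.
have r : star x * star x^-1 = 1 by rewrite -starM mulVr// star1.
have sxu : star x \is a GRing.unit by apply/unitrP; exists (star x^-1).
by apply: (mulIr sxu); rewrite l mulVr.
Qed.

(* The Cayley transform [z] below is unitary, with imaginary part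
   [2 h (1 + h^2)^-1]. *)
Lemma cnorm_div_one_sqr h : star h = h -> cnorm (h * (1 + h ^+ 2)^-1) <= 2^-1.
Proof.
move=> hh; set m := 1 + h ^+ 2; pose ih := 'i%C *: h.
have mu : m \is a GRing.unit := one_sqr_unit hh.
have ihih : ih * ih = - h ^+ 2.
  by rewrite /ih -scalerAl -scalerAr scalerA -expr2 sqr_i scaleN1r expr2.
have sih : star ih = - ih.
  rewrite /ih starZ hh -scaleNr; congr (_ *: _).
  by apply/eqP; rewrite eq_complex /= oppr0 !eqxx.
pose p := 1 + ih; pose q := 1 - ih.
have qp : q * p = m by rewrite /q /p sub_sqr_comm ?mulr1 ?mul1r// ihih opprK.
have pq : p * q = m.
  by rewrite /q /p -{1}[ih]opprK sub_sqr_comm mulr1 ?mul1r// mulrNN ihih opprK.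
have mp : GRing.comm m p by rewrite /GRing.comm -{1}pq -mulrA qp.
have mq : GRing.comm m q by rewrite /GRing.comm -{1}qp -mulrA pq.
have jp : GRing.comm p m^-1 by apply/commrV/commr_sym.
have jq : GRing.comm q m^-1 by apply/commrV/commr_sym.
have sp : star p = q by rewrite /p starD star1 sih.
have sm : star m^-1 = m^-1 by rewrite starV// starD starX star1 hh.
(* Since [m = p q], this is [(1 + i h) (1 - i h)^-1], written with the single inverse [m^-1], which
   commutes with [p] and [q]. *)
pose z := p * p * m^-1.
have sz : star z = q * q * m^-1.
  by rewrite /z !starM sm sp (commrM (commr_sym jq) (commr_sym jq)).
have z1 : cnorm z ^+ 2 = 1.
  have cpp : m^-1 * (p * p) = p * p * m^-1.
    exact: commrM (commr_sym jp) (commr_sym jp).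
  have qqpp : q * q * (p * p) = m * m.
    by rewrite -mulrA [q * (p * p)]mulrA qp mulrA -mq -mulrA qp.
  rewrite -cnorm_star sz /z mulrA -[q * q * m^-1 * _]mulrA cpp mulrA qqpp.
  by rewrite mulrK// divrr// cnorm1.
have {}z1 : cnorm z = 1.
  by apply/eqP; rewrite -(@eqrXn2 _ 2) ?expr1n ?z1 ?cnorm_ge0.
(* Difference of squares [p^2 - q^2], with [p + q = 2] and [p - q = 2 i h]. *)
have zz : z - star z = (4 * 'i%C) *: (h * m^-1).
  rewrite sz /z -mulrBl -sub_sqr_comm ?qp ?pq//.
  have -> : p + q = 1 + 1 by rewrite /p /q addrACA subrr addr0.
  have -> : p - q = ih + ih by rewrite /p /q opprB addrC addrA subrK.
  by rewrite mulrDr mulr1 -!mulr2n -mulrnA -scalerA scalerAl -/ih scaler_nat mulrnAl.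
have : cnorm (z - star z) <= 2.
  rewrite (le_trans (cnormD _ _))// cnormN cnorm_star_eq z1.
  by rewrite -[2]/(1 + 1).
rewrite zz cnormZ normrM; have -> : complex.Re (`|4| * `|'i%C|) = 4 :> R.
  have -> : `|'i%C| = 1 :> R[i] by rewrite normc_def /= expr0n expr1n add0r sqrtr1.
  by rewrite mulr1 normr_nat -(rmorph_nat (real_complex R)).
by move=> ?; lra.
Qed.

(* If [1 - h^2] were invertible then, for [g k = h^(2^k)], the elements
   [D k = g k ^ 2 (1 - g k ^ 2)^-1] would satisfy both [2^-1 <= |D k|] and
   [|D k.+1| <= |D k| / 2]. *)
Lemma one_sub_sqr_nonunit h : star h = h -> cnorm h = 1 ->
  1 - h ^+ 2 \isn't a GRing.unit.
Proof.
move=> hh h1; apply/negP => u; pose g k := h ^+ (2 ^ k).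
have gS k : g k.+1 = g k ^+ 2 by rewrite /g -exprM expnSr.
have gh k : star (g k) = g k by rewrite /g starX hh.
have g1 k : cnorm (g k) = 1.
  elim: k => [|k IH]; first by rewrite /g expn0 expr1.
  by rewrite gS expr2 -{1}(gh k) cnorm_star IH expr1n.
have fact k : 1 - g k.+1 ^+ 2 = (1 - g k ^+ 2) * (1 + g k ^+ 2).
  by rewrite gS sub_sqr_comm ?mulr1 ?mul1r.
have gu k : 1 - g k ^+ 2 \is a GRing.unit.
  elim: k => [|k IH]; first by rewrite /g expn0 expr1.
  by rewrite fact unitrMl// one_sqr_unit.
pose D k := g k ^+ 2 * (1 - g k ^+ 2)^-1.
(* [g k ^ 2] has norm 1 and equals [D k (1 - g k ^ 2)], whose second factor has norm at most 2. *)
have D_ge k : 2^-1 <= cnorm (D k).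
  have : cnorm (g k ^+ 2) <= cnorm (D k) * 2.
    rewrite -[X in cnorm X <= _](mulrVK (gu k)) (le_trans (cnormM _ _))//.
    rewrite ler_wpM2l ?cnorm_ge0// (le_trans (cnormD _ _))// cnormN cnorm1.
    by rewrite -gS g1.
  rewrite -gS g1; lra.
(* [D k.+1] is [D k] multiplied by [g k], of norm 1, and by [g k (1 + g k ^ 2)^-1], of norm at most
   1/2 by the Cayley bound. *)
have DS k : cnorm (D k.+1) <= 2^-1 * cnorm (D k).
  have c : GRing.comm (g k ^+ 2) (1 + g k ^+ 2)^-1.
    by apply/commrV; rewrite /GRing.comm mulrDl mulrDr mulr1 mul1r.
  have -> : D k.+1 = (g k ^+ 2 * (1 + g k ^+ 2)^-1) * D k.
    rewrite /D fact gS invrM// ?one_sqr_unit//.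
    move: c; move: (1 - _)^-1 => i; move: (1 + _)^-1 => j; move: (g k ^+ 2) => G cGj.
    by rewrite expr2 -!mulrA [j * (G * i)]mulrA -cGj -!mulrA.
  rewrite (le_trans (cnormM _ _))// ler_wpM2r ?cnorm_ge0// expr2 -mulrA.
  by rewrite (le_trans (cnormM _ _))// g1 mul1r -expr2 cnorm_div_one_sqr.
have Dk k : cnorm (D k) <= cnorm (D 0) * 2^-1 ^+ k.
  elim: k => [|k IH]; first by rewrite expr0 mulr1.
  rewrite (le_trans (DS _))// exprS mulrCA ler_wpM2l// invr_ge0//.
have [|//|N /(_ N (leqnn N))] := @geometric_lt _ 2^-1 2^-1 (cnorm (D 0)).
  by rewrite invr_ge0 ler0n /= invf_lt1// ltr1n.
by have := Dk N; have := D_ge N; lra.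
Qed.

(** The spectral radius equals the norm and is attained. After scaling to norm 1,
    [1 - k^2 = (1 - k) (1 + k)] is not invertible, so one of the factors is not, and 1 or -1 is a
    spectral value. *)
Lemma herm_norm_spectrum h : star h = h ->
  exists2 t, spectrum h t%:C%C & `|t| = cnorm h.
Proof.
move=> hh; have [h0|h0] := eqVneq (cnorm h) 0.
  exists 0; last by rewrite normr0.
  by rewrite /spectrum /= (cnorm_eq0 _ h0) rmorph0 scale0r subrr unitr0.
set r := cnorm h in h0; have r0 : 0 < r by rewrite lt_def h0 cnorm_ge0.
pose k := rsc r^-1 * h.
have kh : star k = k by rewrite /k starM hh star_rsc rscC.
have k1 : cnorm k = 1.
  by rewrite /k cnorm_rscM gtr0_norm ?invr_gt0// mulVf.
have kE : h = rsc r * k by rewrite /k mulrA -rmorphM divff// rmorph1 mul1r.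
have ru : rsc r \is a GRing.unit by apply: rsc_unit.
have := one_sub_sqr_nonunit kh k1.
have -> : 1 - k ^+ 2 = (1 - k) * (1 + k) by rewrite sub_sqr_comm ?mulr1 ?mul1r.
have [u1|nu1 _] := boolP (1 - k \is a GRing.unit).
  rewrite unitrMr// => nu2; exists (- r); last by rewrite normrN gtr0_norm.
  have nu : rsc r + h \isn't a GRing.unit.
    by have -> : rsc r + h = rsc r * (1 + k); rewrite ?unitrMr// mulrDr mulr1 -kE.
  by rewrite /spectrum /= -/(rscalar _) rmorphN -opprD unitrN.
exists r; last by rewrite gtr0_norm.
rewrite /spectrum /= -/(rscalar _).
by have -> : rsc r - h = rsc r * (1 - k); rewrite ?unitrMr// mulrBr mulr1 -kE.
Qed.

End HermitianSpectrum.

(** * Positivity and the order of hermitian elements *)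

Section Positivity.
Context {R : realType} {A : cstarAlgType R}.
Implicit Types (a b c x y z h : A) (s t e : R).
Local Notation rsc := (@rscalar R A).

Lemma spectrum_rsc x t : spectrum x t%:C%C = (rsc t - x \isn't a GRing.unit).
Proof. by []. Qed.

Lemma spectrum_rscB x s t :
  spectrum (rsc s - x) t%:C%C = spectrum x (s - t)%:C%C.
Proof.
by rewrite !spectrum_rsc rmorphB -unitrN opprB addrAC.
Qed.

Lemma spectrum_Drsc x s t :
  spectrum (x + rsc s) t%:C%C = spectrum x (t - s)%:C%C.
Proof.
by rewrite !spectrum_rsc rmorphB opprD addrA addrAC.
Qed.

(** A hermitian element has real spectrum, so positivity says that no negative number is a spectral
    value, that is, that the shifts [x + t] are invertible. Proving positivity thus becomes
    factoring such shifts. *)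
Definition nonneg x := star x = x /\ forall t, 0 < t -> x + rsc t \is a GRing.unit.

Definition posunit x := nonneg x /\ x \is a GRing.unit.

Definition cle x y := nonneg (y - x).

Lemma nonneg_spectrum x t : nonneg x -> spectrum x t%:C%C -> 0 <= t.
Proof.
move=> [_ xu] xt; rewrite leNgt; apply/negP => t0.
have := xu (- t); rewrite oppr_gt0 => /(_ t0).
rewrite -unitrN opprD rmorphN opprK addrC => u.
by move/negP : xt; apply.
Qed.

Lemma spectrum_nonneg x : star x = x -> (forall t, spectrum x t%:C%C -> 0 <= t) ->
  nonneg x.
Proof.
move=> xh x0; split => // t t0; apply/negPn/negP => nu.
have : spectrum x (- t)%:C%C.
  by rewrite /spectrum /= -/(rscalar _) -unitrN opprB rmorphN opprK.
by move/x0; rewrite oppr_ge0 leNgt t0.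
Qed.

Lemma nonneg_herm x : nonneg x -> star x = x. Proof. by case. Qed.

(** [x + t] is [(s + t) - (s - x)], and the norm of [s - x] is below [s + t]. Together with the
    converse [nonneg_cnorm_le] this is a norm criterion for positivity. *)
Lemma cnorm_le_nonneg s x : star x = x -> cnorm (rsc s - x) <= s -> nonneg x.
Proof.
move=> xh xs; split => // t t0; have -> : x + rsc t = (s + t)%:C%C%:A - (rsc s - x).
  by rewrite -/(rscalar _) rmorphD opprB addrCA addrAC subrr add0r.
rewrite scalar_sub_unit// (le_lt_trans xs)// normc_def /= expr0n addr0 sqrtr_sqr.
by rewrite (lt_le_trans _ (ler_norm _))// ltrDl.
Qed.

Lemma nonneg_cnorm_le s x : nonneg x -> cnorm x <= s -> cnorm (rsc s - x) <= s.
Proof.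
move=> x0 xs; have [|t ts <-] := @herm_norm_spectrum R A (rsc s - x).
  by rewrite starB star_rsc nonneg_herm.
have st : spectrum x (s - t)%:C%C by rewrite -spectrum_rscB.
have := nonneg_spectrum x0 st; have := spectrum_le st.
rewrite normc_def /= expr0n addr0 sqrtr_sqr => le1 ge0.
by rewrite ler_norml; move: le1; rewrite ger0_norm// => le1; lra.
Qed.

(** The spectra of two noncommuting elements do not locate that of their sum, but the norm
    criterion, applied with [s = |x|] and [s = |y|], adds up. *)
Lemma nonnegD x y : nonneg x -> nonneg y -> nonneg (x + y).
Proof.
move=> x0 y0; apply: (@cnorm_le_nonneg (cnorm x + cnorm y)).
  by rewrite starD !nonneg_herm.
by rewrite rmorphD opprD addrACA (le_trans (cnormD _ _))// lerD// nonneg_cnorm_le.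
Qed.

Lemma nonneg_rsc t : 0 <= t -> nonneg (rsc t).
Proof.
move=> t0; split=> [|s s0]; first exact: star_rsc.
by rewrite -rmorphD rsc_unit// gt_eqF// ltr_wpDl.
Qed.

Lemma nonnegZ t x : 0 <= t -> nonneg x -> nonneg (rsc t * x).
Proof.
rewrite le_eqVlt => /predU1P[<- _|t0 [xh xu]].
  by rewrite rmorph0 mul0r -(rmorph0 rsc); exact: nonneg_rsc.
split=> [|s s0]; first by rewrite starM star_rsc xh rscC.
have -> : rsc t * x + rsc s = rsc t * (x + rsc (s / t)).
  by rewrite mulrDr -rmorphM mulrCA divff ?gt_eqF// mulr1.
by rewrite unitrMr ?rsc_unit ?gt_eqF// xu// divr_gt0.
Qed.

Lemma cle_refl x : cle x x.
Proof. by rewrite /cle subrr -(rmorph0 rsc); exact: nonneg_rsc. Qed.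

Lemma cle_trans x y z : cle x y -> cle y z -> cle x z.
Proof.
by move=> xy yz; have := nonnegD yz xy; rewrite addrA subrK.
Qed.

Lemma cleD x y x' y' : cle x y -> cle x' y' -> cle (x + x') (y + y').
Proof. by move=> xy xy'; have := nonnegD xy xy'; rewrite addrACA -opprD. Qed.

Lemma cleZ t x y : 0 <= t -> cle x y -> cle (rsc t * x) (rsc t * y).
Proof. by move=> t0 xy; rewrite /cle -mulrBr; exact: nonnegZ. Qed.

Lemma cle_rsc s t : s <= t -> cle (rsc s) (rsc t).
Proof. by move=> st; rewrite /cle -rmorphB; apply: nonneg_rsc; rewrite subr_ge0. Qed.

Lemma cle_nonneg x : cle 0 x <-> nonneg x.
Proof. by rewrite /cle subr0. Qed.

Lemma herm_cle_cnorm h s : star h = h -> cnorm h <= s -> cle h (rsc s).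
Proof.
move=> hh hs; apply: (@cnorm_le_nonneg s); first by rewrite starB star_rsc hh.
by rewrite opprB addrCA subrr addr0.
Qed.

Lemma cle_cnorm h s : cle h (rsc s) -> cle (- h) (rsc s) -> cnorm h <= s.
Proof.
move=> h1 h2; have hh : star h = h.
  move/nonneg_herm : h1; rewrite starB star_rsc => /addrI/eqP.
  by rewrite eqr_opp => /eqP.
have [t ht <-] := herm_norm_spectrum hh.
rewrite ler_norml; apply/andP; split.
  have -> : - s <= t = (0 <= s + t) by rewrite -subr_ge0 opprK addrC.
  apply: nonneg_spectrum h2 _.
  by rewrite opprK addrC spectrum_Drsc addrC addKr.
rewrite -subr_ge0; apply: nonneg_spectrum h1 _.
by rewrite spectrum_rscB subKr.
Qed.

End Positivity.

(** * Positive invertible elements, congruences and inversion *)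

Section PositiveUnits.
Context {R : realType} {A : cstarAlgType R}.
Implicit Types (a b c x y z h : A) (s t e : R).
Local Notation rsc := (@rscalar R A).

Lemma jacobson_unit x y : 1 + x * y \is a GRing.unit -> 1 + y * x \is a GRing.unit.
Proof.
move=> u; set v := (1 + x * y)^-1.
have ul : (1 + x * y) * v = 1 by rewrite divrr.
have ur : v * (1 + x * y) = 1 by rewrite mulVr.
(* The witness is read off the formal series of [(1 + y x)^-1], in which every term but the first
   has the form [y (...) x]. *)
apply/unitrP; exists (1 - y * v * x); split.
  have -> : (1 - y * v * x) * (1 + y * x) = 1 + y * x - y * (v * (1 + x * y)) * x.
    by rewrite mulrDr !mulrBl !mul1r mulr1 !mulrDr mulr1 mulrDl !mulrA opprD addrACA addrA addrAC.
  by rewrite ur mulr1 addrK.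
have -> : (1 + y * x) * (1 - y * v * x) = 1 + y * x - y * ((1 + x * y) * v) * x.
  by rewrite mulrBr !mulrDl !mul1r mulr1 !mulrDr mulrDl !mulrA.
by rewrite ul mulr1 addrK.
Qed.

Lemma posunit_cnormV_gt0 x : x \is a GRing.unit -> 0 < cnorm x^-1.
Proof.
move=> xu; rewrite lt_def cnorm_ge0 andbT; apply/eqP => /cnorm_eq0 x0.
by move: xu; rewrite -unitrV x0 unitr0.
Qed.

(** With [e = 1 / |x^-1|], the element [x - e + t] is invertible for [t < e] as a perturbation of
    [x] by less than [e], and for [t >= e] by positivity and invertibility of [x]. Positive units
    are therefore exactly the elements above some positive scalar. *)
Lemma posunit_lower x : posunit x -> cle (rsc (cnorm x^-1)^-1) x.
Proof.
move=> [x0 xu]; have n0 := posunit_cnormV_gt0 xu.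
set e := _^-1; have e0 : 0 < e by rewrite invr_gt0.
split=> [|t t0]; first by rewrite starB star_rsc nonneg_herm.
rewrite -addrA -rmorphN -rmorphD; have [te|et] := ltP (- e + t) 0.
  apply: (unit_perturb xu); rewrite opprD addrA subrr sub0r cnormN cnorm_rsc.
  rewrite ltr0_norm// -[ltRHS](mulVf (lt0r_neq0 n0)) ltr_pM2r// -/e; lra.
case: (eqVneq (- e + t) 0) et => [-> _|te et]; first by rewrite rmorph0 addr0.
by apply: x0.2; rewrite lt_def te.
Qed.

Lemma lower_posunit e x : 0 < e -> cle (rsc e) x -> posunit x.
Proof.
move=> e0 ex; split; last by have := ex.2 _ e0; rewrite subrK.
apply/cle_nonneg/(cle_trans _ ex); rewrite -(rmorph0 rsc).
exact/cle_rsc/ltW.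
Qed.

Lemma posunit_gt0 x : posunit x -> exists2 e, 0 < e & cle (rsc e) x.
Proof.
move=> xp; exists (cnorm x^-1)^-1; last exact: posunit_lower.
by rewrite invr_gt0 posunit_cnormV_gt0//; case: xp.
Qed.

Lemma nonneg_posunitD x y : nonneg x -> posunit y -> posunit (x + y).
Proof.
move=> x0 /posunit_gt0[e e0 ey]; apply: (lower_posunit e0).
by rewrite -[rsc e]add0r; apply: cleD ey; apply/cle_nonneg.
Qed.

Lemma cle_posunit x y : posunit x -> cle x y -> posunit y.
Proof. by move=> x0 xy; have := nonneg_posunitD xy x0; rewrite subrK. Qed.

Lemma posunitZ t x : 0 < t -> posunit x -> posunit (rsc t * x).
Proof.
move=> t0 [x0 xu]; split; first exact/nonnegZ/x0/ltW.
by rewrite unitrMr// rsc_unit// gt_eqF.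
Qed.

Lemma posunitV x : posunit x -> posunit x^-1.
Proof.
move=> [x0 xu]; split; last by rewrite unitrV.
split=> [|t t0]; first by rewrite starV// nonneg_herm.
have -> : x^-1 + rsc t = x^-1 * (rsc t * (x + rsc t^-1)).
  by rewrite mulrDr -rmorphM divff ?gt_eqF// rmorph1 mulrDr mulr1 rscC mulKr// addrC.
rewrite unitrMr ?unitrV// unitrMr ?rsc_unit ?gt_eqF//.
by apply: x0.2; rewrite invr_gt0.
Qed.

Lemma nonneg_sqr h : star h = h -> nonneg (h * h).
Proof.
move=> hh; split=> [|t t0]; first by rewrite starM hh.
have r0 : Num.sqrt t != 0 by rewrite gt_eqF// sqrtr_gt0.
pose k := rsc (Num.sqrt t)^-1 * h.
have -> : h * h + rsc t = rsc t * (1 + k ^+ 2).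
  rewrite mulrDr mulr1 addrC; congr (_ + _).
  rewrite expr2 /k -!mulrA [h * (_ * _)]mulrA -rscC !mulrA -!rmorphM.
  by rewrite -{1}(sqr_sqrtr (ltW t0)) expr2 mulfK// divff// rmorph1 mul1r.
rewrite unitrMr ?rsc_unit ?gt_eqF// one_sqr_unit// /k starM hh star_rsc.
by rewrite rscC.
Qed.

(** Taking [c] out on both sides of [c a c + t] leaves [a + t c^-2], a nonnegative element plus a
    positive unit. *)
Lemma nonneg_sandwich_unit c a : star c = c -> c \is a GRing.unit -> nonneg a ->
  nonneg (c * a * c).
Proof.
move=> ch cu a0; split=> [|t t0]; first by rewrite !starM ch nonneg_herm// mulrA.
have -> : c * a * c + rsc t = c * (a + rsc t * (c^-1 * c^-1)) * c.
  rewrite mulrDr mulrDl; congr (_ + _).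
  by rewrite mulrA -rscC -!mulrA mulVr// mulr1 divrr// mulr1.
rewrite unitrMl// unitrMr//; have [] // := @nonneg_posunitD a (rsc t * (c^-1 * c^-1)) a0.
apply: posunitZ => //; split; last by rewrite unitrMr unitrV.
by apply: nonneg_sqr; rewrite starV// ch.
Qed.

(* Jacobson's lemma moves one factor [h] across, which spares the square root
   of [a]. *)
Lemma nonneg_sandwich_posunit h a : star h = h -> posunit a ->
  nonneg (h * a * h).
Proof.
move=> hh ap; have [a0 au] := ap; split=> [|t t0].
  by rewrite !starM hh nonneg_herm// mulrA.
have t1 : rsc t * rsc t^-1 = 1 by rewrite -rmorphM divff ?gt_eqF// rmorph1.
have -> : h * a * h + rsc t = rsc t * (1 + h * (rsc t^-1 * a * h)).
  by rewrite mulrDr mulr1 addrC 2!(mulrA h) -rscC !mulrA t1 mul1r.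
rewrite unitrMr ?rsc_unit ?gt_eqF//; apply: jacobson_unit.
have -> : 1 + rsc t^-1 * a * h * h = rsc t^-1 * a * (rsc t * a^-1 + h * h).
  rewrite mulrDr mulrA; congr (_ + _); last by rewrite !mulrA.
  by rewrite -(mulrA (rsc _)) -rscC mulrA -rscC t1 mul1r divrr.
rewrite !unitrMr ?rsc_unit ?gt_eqF ?invr_gt0//.
rewrite addrC; have [] // := @nonneg_posunitD (h * h) (rsc t * a^-1).
  exact: nonneg_sqr.
by apply: posunitZ => //; exact: posunitV.
Qed.

(** With [d = b - a], the difference [a^-1 - b^-1] is [b^-1 (d + d a^-1 d) b^-1], a congruence of a
    sum of two nonnegative elements. *)
Lemma cle_posunitV a b : posunit a -> cle a b -> cle b^-1 a^-1.
Proof.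
move=> ap ab; have [b0 bu] := cle_posunit ap ab; have [a0 au] := ap.
set d := b - a; have bE : b = a + d by rewrite /d addrC subrK.
have -> : b^-1 = b^-1 * b * b^-1 by rewrite mulVr// mul1r.
have -> : a^-1 = b^-1 * (b * a^-1 * b) * b^-1.
  by rewrite !mulrA mulVr// mul1r mulrK.
rewrite /cle -mulrBl -mulrBr; apply: nonneg_sandwich_unit; rewrite ?unitrV//.
  by rewrite starV// nonneg_herm.
have -> : b * a^-1 * b - b = d + d * a^-1 * d.
  rewrite {1}bE mulrDl divrr// mulrDl mul1r addrAC subrr add0r.
  by rewrite bE mulrDr mulrVK.
apply: nonnegD => //; apply: nonneg_sandwich_posunit; last exact: posunitV.
exact: nonneg_herm.
Qed.

End PositiveUnits.

(** * Functional calculus *)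

Section PolynomialCalculus.
Context {R : realType} {A : cstarAlgType R}.
Implicit Types (x y z h : A) (s t e : R) (p q : {poly R}).
Local Notation rsc := (@rscalar R A).

Definition peval (x : A) (p : {poly R}) : A :=
  horner_alg x (map_poly (real_complex R) p).

Lemma peval_is_additive x : zmod_morphism (peval x).
Proof. by move=> p q; rewrite /peval !rmorphB. Qed.
HB.instance Definition _ x :=
  GRing.isZmodMorphism.Build {poly R} A (peval x) (peval_is_additive x).
Lemma peval_is_multiplicative x : monoid_morphism (peval x).
Proof. by split=> [|p q]; rewrite /peval ?rmorph1// !rmorphM. Qed.
HB.instance Definition _ x :=
  GRing.isMonoidMorphism.Build {poly R} A (peval x) (peval_is_multiplicative x).

Lemma pevalC x t : peval x t%:P = rsc t.
Proof. by rewrite /peval map_polyC horner_algC. Qed.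

Lemma pevalX x : peval x 'X = x.
Proof. by rewrite /peval map_polyX horner_algX. Qed.

Lemma peval_herm h p : star h = h -> star (peval h p) = peval h p.
Proof.
move=> hh; elim/poly_ind: p => [|p c IH]; first by rewrite rmorph0 star0.
have c1 : peval h 'X * peval h p = peval h p * peval h 'X by rewrite -!rmorphM mulrC.
by rewrite pevalX in c1; rewrite rmorphD rmorphM /= pevalX pevalC starD starM IH hh star_rsc c1.
Qed.

(** Spectral mapping: [p - s] splits into linear factors over the complex numbers. If its value at
    [h] is not invertible, some root is a spectral value of [h], hence real. *)
Lemma spectrum_peval h p s : star h = h -> spectrum (peval h p) s%:C%C ->
  exists2 t, spectrum h t%:C%C & p.[t] = s.
Proof.
move=> hh; rewrite spectrum_rsc -unitrN opprB -(pevalC h) -rmorphB /= /peval.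
set Q := map_poly _ _.
have Qroot t : root Q t%:C%C -> p.[t] = s.
  rewrite /Q rootE horner_map hornerD hornerN hornerC fmorph_eq0.
  by rewrite subr_eq0 => /eqP.
(* When [p] is the constant [s] any spectral value will do, and the spectrum is nonempty. *)
have [Q0 _|Q0] := eqVneq Q 0.
  have [t ht _] := herm_norm_spectrum hh; exists t => //.
  by apply: Qroot; rewrite Q0 root0.
have [r Qr] := closed_field_poly_normal Q; rewrite {1}Qr.
rewrite -mul_polyC rmorphM /= horner_algC -scalerAl mul1r.
rewrite scaler_unit ?unitfE ?lead_coef_eq0// rmorph_prod => nu.
have [z zr zh] : exists2 z, z \in r & spectrum h z.
  apply: contrapT => nz; move/negP: nu; apply.
  rewrite big_seq; apply: (big_ind (fun u => u \is a GRing.unit)) => //=.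
  - exact: unitr1.
  - by move=> u v uu vu; rewrite unitrMr.
  - move=> z zr; rewrite rmorphB /= horner_algX horner_algC -unitrN opprB.
    by apply: contrapT => /negP zh; apply: nz; exists z.
have zE := herm_spectrum_real hh zh; rewrite zE in zr zh *.
exists (complex.Re z) => //; apply: Qroot; rewrite Qr rootZ ?lead_coef_eq0//.
by rewrite root_prod_XsubC.
Qed.

Lemma peval_spectrum h p t : star h = h -> spectrum h t%:C%C ->
  spectrum (peval h p) p.[t]%:C%C.
Proof.
move=> hh; rewrite !spectrum_rsc -unitrN opprB => ht.
have /factor_theorem[q qE] : root (p - p.[t]%:P) t.
  by rewrite rootE hornerD hornerN hornerC subrr.
rewrite -unitrN opprB -(pevalC h) -rmorphB qE rmorphM rmorphB /= pevalX pevalC.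
rewrite unitrM_comm ?(negPf ht) ?andbF//.
have -> : h - rsc t = peval h ('X - t%:P) by rewrite rmorphB /= pevalX pevalC.
by rewrite /GRing.comm -!rmorphM mulrC.
Qed.

Lemma peval_le h p t : star h = h -> spectrum h t%:C%C ->
  `|p.[t]| <= cnorm (peval h p).
Proof.
move=> hh /(peval_spectrum p hh)/spectrum_le.
by rewrite normc_def /= expr0n addr0 sqrtr_sqr.
Qed.

(** With [peval_le], the norm of [peval h p] is the maximum of [|p|] on the spectrum. This isometry
    yields uniqueness and existence of limits in the calculus. *)
Lemma peval_norm h p : star h = h ->
  exists2 t, spectrum h t%:C%C & `|p.[t]| = cnorm (peval h p).
Proof.
move=> hh; have [s sp <-] := herm_norm_spectrum (peval_herm p hh).
by have [t ht <-] := spectrum_peval hh sp; exists t.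
Qed.

(* [fcalc f x y] says that [y] is [f x]; unlike in [is_cfc], [y] need not be
   bundled as a hermitian element. *)
Definition fcalc (f : R -> R) (x y : A) := forall e, 0 < e ->
  exists2 p, forall t, spectrum x t%:C%C -> `|f t - p.[t]| <= e &
    cnorm (peval x p - y) <= e.

Lemma fcalc_cnorm f g (h y z : A) C : star h = h -> fcalc f h y -> fcalc g h z ->
  (forall t, spectrum h t%:C%C -> `|f t - g t| <= C) -> cnorm (y - z) <= C.
Proof.
move=> hh fy gz fg; apply/ler_addgt0Pl => e e0.
have e4 : 0 < e / 4 by rewrite divr_gt0.
have [p pf py] := fy _ e4; have [q qg qz] := gz _ e4.
have [t ht tn] := peval_norm (p - q) hh.
have pq : cnorm (peval h p - peval h q) <= C + e / 4 + e / 4.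
  rewrite -rmorphB -tn hornerD hornerN.
  have -> : p.[t] - q.[t] = (f t - g t) - (f t - p.[t]) + (g t - q.[t]) by ring.
  by rewrite (le_trans (ler_normD _ _))// lerD ?qg// (le_trans (ler_normB _ _))// lerD ?fg ?pf.
rewrite cnormB in py.
have := cnorm_tri y (peval h p) z; have := cnorm_tri (peval h p) (peval h q) z.
lra.
Qed.

Lemma fcalc_uniq f g (h y z : A) : star h = h -> fcalc f h y -> fcalc g h z ->
  (forall t, spectrum h t%:C%C -> f t = g t) -> y = z.
Proof.
move=> hh fy gz fg; apply/eqP; rewrite -subr_eq0; apply/eqP/cnorm_small => e e0.
by apply: fcalc_cnorm hh fy gz _ => t /fg ->; rewrite subrr normr0 ltW.
Qed.

Lemma fcalc_ext f g (h y : A) : fcalc f h y ->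
  (forall t, spectrum h t%:C%C -> f t = g t) -> fcalc g h y.
Proof.
move=> fy fg e e0; have [p pf py] := fy _ e0; exists p => // t ht.
by rewrite -fg// pf.
Qed.

Lemma fcalc_peval p x : fcalc (horner p) x (peval x p).
Proof.
by move=> e e0; exists p => [t _|]; rewrite subrr ?normr0 ?cnorm0 ltW.
Qed.

Lemma fcalc_id x : fcalc id x x.
Proof. by rewrite -{2}(pevalX x); apply: fcalc_ext (fcalc_peval _ _) _ => t; rewrite hornerX. Qed.

Lemma fcalcC s x : fcalc (fun=> s) x (rsc s).
Proof.
by rewrite -(pevalC x); apply: fcalc_ext (fcalc_peval _ _) _ => t; rewrite hornerC.
Qed.

Lemma fcalcD f g x y z : fcalc f x y -> fcalc g x z ->
  fcalc (fun t => f t + g t) x (y + z).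
Proof.
move=> fy gz e e0; have e2 : 0 < e / 2 by rewrite divr_gt0.
have [p pf py] := fy _ e2; have [q qg qz] := gz _ e2.
exists (p + q) => [t xt|]; rewrite (splitr e).
  by rewrite hornerD opprD addrACA (le_trans (ler_normD _ _))// lerD ?pf ?qg.
by rewrite rmorphD opprD addrACA (le_trans (cnormD _ _))// lerD.
Qed.

Lemma fcalc_bounded f h y : star h = h -> fcalc f h y ->
  exists2 C : R, 0 < C & forall t, spectrum h t%:C%C -> `|f t| <= C.
Proof.
move=> hh /(_ _ ltr01)[p pf _]; exists (cnorm (peval h p) + 1).
  by rewrite ltr_wpDl ?cnorm_ge0.
move=> t ht; rewrite -[f t](subrK p.[t]) addrC (le_trans (ler_normD _ _))//.
by rewrite lerD ?peval_le ?pf.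
Qed.

Lemma fcalcM f g h y z : star h = h -> fcalc f h y -> fcalc g h z ->
  fcalc (fun t => f t * g t) h (y * z).
Proof.
move=> hh fy gz e e0.
have [C C0 fC] := fcalc_bounded hh fy; have [D D0 gD] := fcalc_bounded hh gz.
(* [B] collects the factors that an error [d] meets in the two expansions below, once for numbers
   and once in the algebra; [d <= 1] lets the quadratic term [d^2] count as [d]. *)
pose B := C + D + cnorm y + cnorm z + 1.
have B0 : 0 < B by rewrite /B; have := cnorm_ge0 y; have := cnorm_ge0 z; lra.
pose d := Num.min 1 (e / (2 * B)).
have d0 : 0 < d by rewrite lt_min ltr01 divr_gt0// mulr_gt0.
have d1 : d <= 1 by rewrite ge_min lexx.
have dB : d * (2 * B) <= e by rewrite -ler_pdivlMr ?mulr_gt0// ge_min lexx orbT.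
have [p pf py] := fy _ d0; have [q qg qz] := gz _ d0.
have dd : d * d <= d by rewrite ger_pMr.
exists (p * q) => [t ht|].
  rewrite hornerM; have := pf _ ht; have := qg _ ht; have := fC _ ht; have := gD _ ht.
  move: (f t) (g t) (p.[t]) (q.[t]) => u v a b v0 u0 vb ua.
  have -> : u * v - a * b = u * (v - b) + v * (u - a) - (u - a) * (v - b) by ring.
  rewrite (le_trans (ler_normB _ _))// (le_trans (lerD (ler_normD _ _) (lexx _)))//.
  rewrite !normrM.
  have h1 : `|u| * `|v - b| <= C * d by rewrite ler_pM.
  have h2 : `|v| * `|u - a| <= D * d by rewrite ler_pM.
  have h3 : `|u - a| * `|v - b| <= d * d by rewrite ler_pM.
  have := mulr_ge0 (ltW d0) (cnorm_ge0 y); have := mulr_ge0 (ltW d0) (cnorm_ge0 z).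
  move: dB; rewrite /B; nra.
rewrite rmorphM; set a := peval h p in py *; set b := peval h q in qz *.
have -> : a * b - y * z = (a - y) * (b - z) + (a - y) * z + y * (b - z).
  by rewrite -mulrDr subrK mulrBl mulrBr addrA subrK.
rewrite (le_trans (cnormD _ _))// (le_trans (lerD (cnormD _ _) (lexx _)))//.
have h1 : cnorm ((a - y) * (b - z)) <= d * d.
  by rewrite (le_trans (cnormM _ _))// ler_pM ?cnorm_ge0.
have h2 : cnorm ((a - y) * z) <= d * cnorm z.
  by rewrite (le_trans (cnormM _ _))// ler_pM ?cnorm_ge0.
have h3 : cnorm (y * (b - z)) <= cnorm y * d.
  by rewrite (le_trans (cnormM _ _))// ler_pM ?cnorm_ge0.
have := mulr_ge0 (ltW d0) (ltW C0); have := mulr_ge0 (ltW d0) (ltW D0).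
move: dB; rewrite /B; nra.
Qed.

Lemma cle_closed x y : (forall e, 0 < e -> cle x (y + rsc e)) -> cle x y.
Proof.
move=> xy; split=> [|t t0].
  have := nonneg_herm (xy _ ltr01); rewrite !starB starD star_rsc.
  by rewrite !(addrAC _ (rsc 1)) => /addIr.
have t2 : 0 < t / 2 by rewrite divr_gt0.
have -> : y - x + rsc t = y + rsc (t / 2) - x + rsc (t / 2).
  by rewrite {1}(splitr t) rmorphD addrA [y + _ - _]addrAC.
exact: (xy _ t2).2 _ t2.
Qed.

Lemma fcalc_ge f h y m : star h = h -> star y = y -> fcalc f h y ->
  (forall t, spectrum h t%:C%C -> m <= f t) -> cle (rsc m) y.
Proof.
move=> hh yh fy fm; apply: cle_closed => e e0.
have e2 : 0 < e / 2 by rewrite divr_gt0.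
have [p pf py] := fy _ e2; have ph := peval_herm p hh.
have h1 : cle (peval h p) (y + rsc (e / 2)).
  have := herm_cle_cnorm _ py; rewrite starB ph yh => /(_ erefl) le.
  by have := cleD le (cle_refl y); rewrite subrK addrC.
have h2 : cle (rsc (m - e / 2)) (peval h p).
  apply: spectrum_nonneg; first by rewrite starB ph star_rsc.
  move=> t; rewrite -rmorphN spectrum_Drsc => /(spectrum_peval hh)[s hs pE].
  by have := pf _ hs; rewrite pE ler_norml => /andP[]; have := fm _ hs; lra.
have := cleD (cle_trans h2 h1) (cle_refl (rsc (e / 2))).
by rewrite -(rmorphD rsc) subrK -[y + _ + _]addrA -(rmorphD rsc) -splitr.
Qed.

End PolynomialCalculus.

(** * Uniform polynomial approximation on an interval of positive reals *)

Section PolynomialApproximation.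
Context {R : realType} (m M : R).
Hypothesis m0 : 0 < m.
Implicit Types (f g : R -> R) (p q : {poly R}) (t e d C : R).

(** The class is closed under sums, products, uniform limits, inverses and square roots bounded away
    from 0, which is enough to reach [isqrt] and [ln] by explicit constructions. For a positive
    unit, the spectrum lies in such an interval. *)
Definition poly_approx f := forall e, 0 < e ->
  exists p, forall t, m <= t <= M -> `|f t - p.[t]| <= e.

Lemma poly_bounded p : exists2 C : R, 0 < C & forall t, m <= t <= M -> `|p.[t]| <= C.
Proof.
elim/poly_ind: p => [|p c [C C0 pC]].
  by exists 1 => // t _; rewrite horner0 normr0.
exists (C * (`|M| + 1) + `|c|) => [|t tmM].
  by rewrite ltr_wpDr// mulr_gt0// ltr_wpDl.
rewrite !hornerE (le_trans (ler_normD _ _))// lerD2r normrM ler_pM ?pC//.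
move: tmM => /andP[mt tM]; rewrite ger0_norm; last exact: le_trans (ltW m0) mt.
by have := ler_norm M; lra.
Qed.

Lemma poly_approx_bounded f : poly_approx f ->
  exists2 C : R, 0 < C & forall t, m <= t <= M -> `|f t| <= C.
Proof.
move=> /(_ _ ltr01)[p pf]; have [C C0 pC] := poly_bounded p.
exists (C + 1) => [|t tmM]; first by rewrite addr_gt0.
rewrite -[f t](subrK p.[t]) addrC (le_trans (ler_normD _ _))//.
by rewrite lerD ?pC ?pf.
Qed.

Lemma poly_approx_horner p : poly_approx (horner p).
Proof. by move=> e e0; exists p => t _; rewrite subrr normr0 ltW. Qed.

Lemma poly_approx_lim f : (forall e, 0 < e ->
    exists2 g, poly_approx g & forall t, m <= t <= M -> `|f t - g t| <= e) ->
  poly_approx f.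
Proof.
move=> fg e e0; have e2 : 0 < e / 2 by rewrite divr_gt0.
have [g /(_ _ e2)[p pg] gf] := fg _ e2; exists p => t tmM.
rewrite (splitr e) -[f t](subrK (g t)) -addrA (le_trans (ler_normD _ _))//.
by rewrite lerD ?gf ?pg.
Qed.

Lemma poly_approx_ext f g : poly_approx f ->
  (forall t, m <= t <= M -> f t = g t) -> poly_approx g.
Proof.
by move=> fa fg e /fa[p pf]; exists p => t tmM; rewrite -fg ?pf.
Qed.

Lemma poly_approx_cst C : poly_approx (fun=> C).
Proof. by apply: poly_approx_ext (poly_approx_horner C%:P) _ => t; rewrite hornerC. Qed.

Lemma poly_approx_id : poly_approx id.
Proof. by apply: poly_approx_ext (poly_approx_horner 'X) _ => t; rewrite hornerX. Qed.

Lemma poly_approxD f g : poly_approx f -> poly_approx g ->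
  poly_approx (fun t => f t + g t).
Proof.
move=> fa ga e e0; have e2 : 0 < e / 2 by rewrite divr_gt0.
have [p pf] := fa _ e2; have [q qg] := ga _ e2.
exists (p + q) => t tmM; rewrite (splitr e) hornerD opprD addrACA.
by rewrite (le_trans (ler_normD _ _))// lerD ?pf ?qg.
Qed.

Lemma poly_approxM f g : poly_approx f -> poly_approx g ->
  poly_approx (fun t => f t * g t).
Proof.
move=> fa ga e e0; have [C C0 fC] := poly_approx_bounded fa.
have d0 : 0 < e / 2 / C by rewrite !divr_gt0.
have [q qg] := ga _ d0; have [D D0 qD] := poly_bounded q.
have d'0 : 0 < e / 2 / D by rewrite !divr_gt0.
have [p pf] := fa _ d'0; exists (p * q) => t tmM; rewrite hornerM.
have -> : f t * g t - p.[t] * q.[t] = f t * (g t - q.[t]) + (f t - p.[t]) * q.[t].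
  by ring.
rewrite (le_trans (ler_normD _ _))// !normrM (splitr e) lerD//.
  by rewrite -[leRHS](mulfVK (lt0r_neq0 C0)) mulrC ler_pM ?qg ?fC.
by rewrite -[leRHS](mulfVK (lt0r_neq0 D0)) ler_pM ?qD ?pf.
Qed.

Lemma poly_approxX f n : poly_approx f -> poly_approx (fun t => f t ^+ n).
Proof.
move=> fa; elim: n => [|n IH].
  by apply: poly_approx_ext (poly_approx_cst 1) _ => t; rewrite expr0.
by apply: poly_approx_ext (poly_approxM fa IH) _ => t; rewrite exprS.
Qed.

Lemma poly_approx_sum n (f : nat -> R -> R) : (forall k, poly_approx (f k)) ->
  poly_approx (fun t => \sum_(k < n) f k t).
Proof.
move=> fa; elim: n => [|n IH].
  by apply: poly_approx_ext (poly_approx_cst 0) _ => t; rewrite big_ord0.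
by apply: poly_approx_ext (poly_approxD IH (fa n)) _ => t; rewrite big_ord_recr.
Qed.

(** The geometric series of [1 / f = C^-1 / (1 - u)] with [u = 1 - f / C] converges uniformly, since
    [0 <= u <= 1 - d / C < 1]; the remainder after [N] terms is [u^N / f]. *)
Lemma poly_approxV f d : 0 < d -> (forall t, m <= t <= M -> d <= f t) ->
  poly_approx f -> poly_approx (fun t => (f t)^-1).
Proof.
move=> d0 df fa; have [C' C'0 fC'] := poly_approx_bounded fa.
(* Adding [d] guarantees [d <= C] even when the interval is empty. *)
pose C := C' + d; have C0 : 0 < C by rewrite addr_gt0.
apply: poly_approx_lim => e e0.
have [|N /(_ N (leqnn N)) NP] := @geometric_lt _ (1 - d / C) e d^-1 _ e0.
  rewrite gtrBl divr_gt0// andbT subr_ge0 ler_pdivrMr// mul1r /C.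
  by rewrite lerDr ltW.
exists (fun t => C^-1 * \sum_(k < N) (1 + - C^-1 * f t) ^+ k).
  apply: poly_approxM; first exact: poly_approx_cst.
  apply: (@poly_approx_sum N (fun k t => (1 + - C^-1 * f t) ^+ k)) => k.
  apply: poly_approxX; apply: poly_approxD; first exact: poly_approx_cst.
  by apply: poly_approxM => //; exact: poly_approx_cst.
move=> t tmM; have dft := df _ tmM; have ft0 := lt_le_trans d0 dft.
set u := 1 + - C^-1 * f t.
have u0 : 0 <= u.
  rewrite /u mulNr subr_ge0 mulrC ler_pdivrMr// mul1r /C.
  by rewrite (le_trans (ler_norm _))// (le_trans (fC' _ tmM))// lerDl ltW.
have uC : u <= 1 - d / C by rewrite /u lerD2l mulNr lerN2 [leRHS]mulrC ler_pM2r ?invr_gt0.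
have -> : (f t)^-1 - C^-1 * \sum_(k < N) u ^+ k = (f t)^-1 * u ^+ N.
  have -> : C^-1 = (f t)^-1 * (1 - u).
    by rewrite /u; field; rewrite !lt0r_neq0.
  rewrite -mulrA -[X in X - _]mulr1 -mulrBr -[X in _ * (_ - X)]opprK.
  by rewrite -mulNr opprB -subrX1 opprK addrC subrK.
rewrite ger0_norm; last by rewrite mulr_ge0 ?invr_ge0 ?exprn_ge0// ltW.
apply: le_trans (ltW NP); rewrite ler_pM ?exprn_ge0//; first by rewrite invr_ge0 ltW.
  by rewrite lef_pV2 ?posrE.
by rewrite lerXn2r// nnegrE// (le_trans u0).
Qed.

(* Heron's iteration from [1 + f] halves the error at each step, uniformly. *)
Lemma poly_approx_sqrt f d : 0 < d -> (forall t, m <= t <= M -> d <= f t) ->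
  poly_approx f -> poly_approx (fun t => Num.sqrt (f t)).
Proof.
move=> d0 df fa; have [C C0 fC] := poly_approx_bounded fa.
pose g := fix g k t := if k is k'.+1 then 2^-1 * (g k' t + f t * (g k' t)^-1) else 1 + f t.
have gP k t : m <= t <= M ->
    Num.sqrt (f t) <= g k t <= Num.sqrt (f t) + (1 + C) * 2^-1 ^+ k.
  move=> tmM; have ft0 := lt_le_trans d0 (df _ tmM).
  have fCt := fC _ tmM; rewrite gtr0_norm// in fCt.
  set r := Num.sqrt _; have r0 : 0 < r by rewrite sqrtr_gt0.
  have r2 : f t = r ^+ 2 by rewrite sqr_sqrtr// ltW.
  elim: k => [|k /andP[IH1 IH2]] /=.
    rewrite expr0 mulr1; apply/andP; split; last by lra.
    by rewrite r2; have := sqr_ge0 (r - 1); nra.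
  set x := g k t in IH1 IH2 *; have x0 : 0 < x := lt_le_trans r0 IH1.
  (* The new error is the old one times [(x - r) / (2 x)], a number between 0 and 1/2 because
     [0 < r <= x]. Its sign keeps the iterates above the root, hence away from 0, so that the next
     inversion is uniform. *)
  have E : 2^-1 * (x + f t * x^-1) - r = (x - r) * ((x - r) / (2 * x)).
    by rewrite r2; field; rewrite lt0r_neq0.
  have E1 : 0 <= (x - r) / (2 * x) by rewrite divr_ge0 ?subr_ge0// mulr_ge0 ?ltW.
  have E2 : (x - r) / (2 * x) <= 2^-1 by rewrite ler_pdivrMr ?mulr_gt0//; lra.
  apply/andP; split; first by rewrite -subr_ge0 E mulr_ge0// subr_ge0.
  rewrite -lerBlDl E exprSr [leRHS]mulrA ler_pM ?subr_ge0//.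
  by rewrite lerBlDl.
have ga k : poly_approx (g k).
  elim: k => [|k IH]; first by apply: poly_approxD => //; exact: poly_approx_cst.
  apply: poly_approxM; first exact: poly_approx_cst.
  apply: poly_approxD => //; apply: poly_approxM => //.
  apply: (@poly_approxV _ (Num.sqrt d)) => //; first by rewrite sqrtr_gt0.
  move=> t tmM; have /andP[/(le_trans _)->//] := gP k _ tmM.
  by rewrite ler_wsqrtr// df.
apply: poly_approx_lim => e e0.
have [|N /(_ N (leqnn N)) NP] := @geometric_lt _ 2^-1 e (1 + C) _ e0.
  by rewrite invr_ge0 ler0n /= invf_lt1// ltr1n.
exists (g N) => // t /(gP N)/andP[g1 g2].
by rewrite ler0_norm ?subr_le0// opprB lerBlDl (le_trans g2)// lerD2l ltW.
Qed.

End PolynomialApproximation.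

Section LogarithmApproximation.
Context {R : realType}.
Implicit Types (t s : R) (n k : nat).

(* A Riemann sum for [ln t = \int_0^1 (t - 1) / (1 + s (t - 1)) ds]. *)
Definition ln_sum n t := \sum_(k < n)
  (k.+1%:R)^-1 * (1 - (1 + k.+1%:R / n%:R * (t - 1))^-1).

Lemma ln_le_sub1 t : 0 < t -> ln t <= t - 1.
Proof.
by move=> t0; have := @le_ln1Dx _ (t - 1); rewrite [1 + _]addrC subrK; apply; lra.
Qed.

(** By [1 - 1/v <= ln v <= v - 1] at [v = u k.+1 / u k], each increment of [ln] lies between the
    term of the sum, [1 - u k / u k.+1], and [u k.+1 / u k - 1]. The gaps between these two bounds
    telescope to the right-hand side. *)
Lemma ln_sum_bound n t : (0 < n)%N -> 0 < t ->
  `|ln t - ln_sum n t| <= (t - 1) ^+ 2 / t / n%:R.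
Proof.
move=> n0 t0; have nR : 0 < n%:R :> R by rewrite ltr0n.
pose u k := 1 + k%:R / n%:R * (t - 1).
have u0 : u 0 = 1 by rewrite /u !mul0r addr0.
have un : u n = t by rewrite /u divff ?lt0r_neq0// mul1r addrC subrK.
have up k : (k <= n)%N -> 0 < u k.
  move=> kn; have s1 : k%:R / n%:R <= 1 :> R by rewrite ler_pdivrMr// mul1r ler_nat.
  have s0 : 0 <= k%:R / n%:R :> R by rewrite divr_ge0.
  by rewrite /u; move: (_ / _) s1 s0 => s s1 s0; nra.
have uS k : u k.+1 - u k = (t - 1) / n%:R.
  by rewrite /u -natr1; field; rewrite lt0r_neq0.
have lnE : ln t = \sum_(k < n) (ln (u k.+1) - ln (u k)).
  rewrite -(big_mkord xpredT (fun k => ln (u k.+1) - ln (u k))).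
  by rewrite telescope_sumr// u0 un ln1 subr0.
have VE : (t - 1) ^+ 2 / t / n%:R =
    \sum_(k < n) - ((t - 1) / n%:R * (u k.+1)^-1 - (t - 1) / n%:R * (u k)^-1).
  rewrite -(big_mkord xpredT (fun k => - ((t - 1) / n%:R * (u k.+1)^-1 - (t - 1) / n%:R * (u k)^-1))).
  rewrite sumrN telescope_sumr// u0 un; field.
  by rewrite !lt0r_neq0.
rewrite lnE VE /ln_sum -sumrB.
have bound k : (k < n)%N -> 0 <= ln (u k.+1) - ln (u k) - k.+1%:R^-1 *
    (1 - (u k.+1)^-1) <=
    - ((t - 1) / n%:R * (u k.+1)^-1 - (t - 1) / n%:R * (u k)^-1).
  move=> kn; have a0 := up _ (ltnW kn); have b0 := up _ kn.
  have -> : k.+1%:R^-1 * (1 - (u k.+1)^-1) = 1 - u k / u k.+1.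
    have -> : u k = u k.+1 - (t - 1) / n%:R by rewrite -(uS k) subKr.
    rewrite mulrBl divff ?lt0r_neq0// opprB addrCA subrr addr0.
    have -> : 1 - (u k.+1)^-1 = k.+1%:R * ((t - 1) / n%:R) / u k.+1.
      have b1 := lt0r_neq0 b0; apply: (mulIf b1); rewrite mulrBl mul1r mulVf// mulfVK//.
      by rewrite /u; field; rewrite lt0r_neq0.
    by rewrite -mulrA mulKf ?pnatr_eq0.
  have := @ln_le_sub1 (u k / u k.+1); have := @ln_le_sub1 (u k.+1 / u k).
  rewrite !divr_gt0// !ln_div ?posrE// => /(_ isT) h1 /(_ isT) h2.
  have -> : - ((t - 1) / n%:R * (u k.+1)^-1 - (t - 1) / n%:R * (u k)^-1) =
    (u k.+1 / u k - 1) - (1 - u k / u k.+1).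
    by rewrite -(uS k); field; rewrite !lt0r_neq0.
  by apply/andP; split; lra.
rewrite ger0_norm.
  by apply: ler_sum => k _; have /andP[] := bound k (ltn_ord k).
by apply: sumr_ge0 => k _; have /andP[] := bound k (ltn_ord k).
Qed.

Lemma segment1_ge_min (m s t : R) : 0 <= s <= 1 -> m <= t ->
  Num.min 1 m <= 1 + s * (t - 1).
Proof.
move=> /andP[s0 s1] mt; have lm : Num.min 1 m <= m by rewrite ge_min lexx orbT.
have l1 : Num.min 1 m <= 1 by rewrite ge_min lexx.
by move: (Num.min 1 m) lm l1 => l lm l1; nra.
Qed.

Lemma natr_div_itv k n : (k <= n)%N ->
  0 <= (k%:R / n%:R : R) <= 1.
Proof.
case: n => [|n] kn; first by rewrite invr0 mulr0 lexx ler01.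
by rewrite divr_ge0// ler_pdivrMr ?ltr0n// mul1r ler_nat.
Qed.

Lemma poly_approx_ln (m M : R) : 0 < m -> poly_approx m M (@ln R).
Proof.
move=> m0; apply: poly_approx_lim => // e e0.
pose C := (`|M| + 1) ^+ 2 / m + 1.
have C0 : 0 < C by rewrite ltr_wpDl// divr_ge0 ?sqr_ge0 ?ltW.
pose n := (Num.truncn (C / e)).+1.
have nC : C / n%:R <= e.
  rewrite ler_pdivrMr ?ltr0n// mulrC -ler_pdivrMr// ltW//.
  exact: truncnS_gt.
exists (ln_sum n).
  (* [poly_approx_sum] asks for approximability at every [k]; capping the coefficient at 1 keeps the
     denominator positive beyond [n], and changes nothing for [k < n]. *)
  have ap : forall k, poly_approx m M (fun t => (k.+1%:R)^-1 * (1 -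
      (1 + Num.min 1 (k.+1%:R / n%:R) * (t - 1))^-1)).
    move=> k; apply: poly_approxM => //; first exact: poly_approx_cst.
    apply: poly_approxD => //; first exact: poly_approx_cst.
    apply: (@poly_approx_ext _ _ _ (fun t =>
       -1 * (1 + Num.min 1 (k.+1%:R / n%:R) * (t - 1))^-1)); last first.
      by move=> t _; rewrite mulN1r.
    apply: poly_approxM => //; first exact: poly_approx_cst.
    apply: (@poly_approxV _ _ _ m0 _ (Num.min 1 m)); first by rewrite lt_min ltr01.
      move=> t /andP[mt _]; apply: segment1_ge_min => //.
      by rewrite ge_min lexx le_min ler01 divr_ge0.
    apply: poly_approxD => //; first exact: poly_approx_cst.
    apply: poly_approxM => //; first exact: poly_approx_cst.
    by apply: poly_approxD => //; [exact: poly_approx_id|exact: poly_approx_cst].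
  apply: poly_approx_ext (poly_approx_sum n ap) _ => t _.
  apply: eq_bigr => k _; rewrite min_r//.
  by have /andP[] := natr_div_itv (ltn_ord k).
move=> t /andP[mt tM]; have t0 := lt_le_trans m0 mt.
rewrite (le_trans (ln_sum_bound _ t0))// (le_trans _ nC)//.
rewrite ler_pM2r ?invr_gt0 ?ltr0n// /C.
rewrite (@le_trans _ _ ((`|M| + 1) ^+ 2 / m)) ?lerDl//.
rewrite ler_pM ?sqr_ge0 ?invr_ge0 ?(ltW t0)// ?lef_pV2 ?posrE//.
by rewrite -subr_ge0 subr_sqr mulr_ge0//; have := ler_norm M; lra.
Qed.

End LogarithmApproximation.

Section FunctionalCalculus.
Context {R : realType} {A : cstarAlgType R}.
Implicit Types (x y z h : A) (s t e : R) (p q : {poly R}) (f g : R -> R).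
Local Notation rsc := (@rscalar R A).

Lemma natSinv_lt (e : R) : 0 < e ->
  exists N : nat, forall n, (N <= n)%N -> n.+1%:R^-1 < e.
Proof.
move=> e0; exists (Num.truncn e^-1) => n Nn.
rewrite invf_plt ?posrE// (lt_le_trans (truncnS_gt _))// ler_nat ltnS//.
Qed.

(** Polynomials that converge uniformly on the spectrum have Cauchy values at [h], by the isometry,
    and their limit is hermitian because [star] preserves the norm. *)
Lemma fcalc_exists f h : star h = h ->
  (forall e, 0 < e ->
    exists p, forall t, spectrum h t%:C%C -> `|f t - p.[t]| <= e) ->
  exists2 y, star y = y & fcalc f h y.
Proof.
move=> hh fp.
have /choice[P Pf] : forall n : nat, exists p, forall t, spectrum h t%:C%C ->
    `|f t - p.[t]| <= n.+1%:R^-1.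
  by move=> n; apply: fp; rewrite invr_gt0.
have d m n : cnorm (peval h (P m) - peval h (P n)) <= m.+1%:R^-1 + n.+1%:R^-1.
  apply: fcalc_cnorm hh (fcalc_peval _ _) (fcalc_peval _ _) _ => t ht.
  have -> : (P m).[t] - (P n).[t] = (f t - (P n).[t]) - (f t - (P m).[t]) by ring.
  by rewrite (le_trans (ler_normB _ _))// addrC lerD ?Pf.
have [y yP] : exists l, forall e : R, 0 < e -> exists N : nat, forall n : nat,
    (N <= n)%N -> cnorm (peval h (P n) - l) < e.
  apply: cnorm_complete => e e0; have [|N NP] := @natSinv_lt (e / 2).
    by rewrite divr_gt0.
  exists N => m n Nm Nn; rewrite (le_lt_trans (d m n))// (splitr e).
  by rewrite ltrD ?NP.
exists y.
  apply/eqP; rewrite -subr_eq0; apply/eqP/cnorm_small => e e0.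
  have [|N /(_ N (leqnn N))] := yP (e / 2); first by rewrite divr_gt0.
  set u := peval _ _ => uy; have uh : star u = u by exact: peval_herm.
  rewrite (le_trans (cnorm_tri _ u _))// (splitr e) lerD ?(ltW uy)//.
  by rewrite -{1}uh -starB cnorm_star_eq cnormB ltW.
move=> e e0; have [N NP] := yP _ e0; have [N' NP'] := natSinv_lt e0.
exists (P (maxn N N')) => [t ht|].
  by rewrite (le_trans (Pf _ _ ht))// ltW// NP'// leq_maxr.
by rewrite ltW// NP// leq_maxl.
Qed.

Lemma posunit_spectrum m M x t : cle (rsc m) x -> cnorm x <= M ->
  spectrum x t%:C%C -> m <= t <= M.
Proof.
move=> mx xM xt; apply/andP; split.
  rewrite -subr_ge0; apply: nonneg_spectrum mx _.
  by rewrite -rmorphN spectrum_Drsc opprK subrK.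
apply: le_trans xM; have := spectrum_le xt.
by rewrite normc_def /= expr0n addr0 sqrtr_sqr; exact: le_trans (ler_norm _).
Qed.

Lemma fcalc_posunit f x : (forall m M : R, 0 < m -> poly_approx m M f) ->
  posunit x -> exists2 y, star y = y & fcalc f x y.
Proof.
move=> fa xp; have [m m0 mx] := posunit_gt0 xp.
apply: fcalc_exists => [|e e0]; first exact: nonneg_herm xp.1.
have [p pf] := fa m (cnorm x) m0 e e0.
by exists p => t xt; apply: pf; apply: posunit_spectrum xt.
Qed.

Lemma is_cfcP f (a y : herm A) : is_cfc f a y <-> fcalc f a y.
Proof.
have entE e : 0 < e -> @entourage R [set uv | `|uv.1 - uv.2| <= e].
  move=> e0; apply: filterS (entourage_ball _ (PosNum e0)) => uv /=.
  by rewrite /ball/= => /ltW.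
split=> [[p [pf py]] e e0|fy].
  have [N _ NP] : \forall n \near \oo, forall t, real_spectrum a t ->
      `|f t - (p n).[t]| <= e.
    apply: (pf [set g : R -> R | forall t, real_spectrum a t -> `|f t - g t| <= e]).
    by apply/uniform_nbhs; eexists; split; first exact: (entE _ e0).
  have /cvgrPdist_le /(_ _ e0)[N' _ NP'] := py.
  exists (p (maxn N N')); first by apply: NP; exact: leq_maxl.
  have := NP' (maxn N N') (leq_maxr _ _); rewrite /= sub0r normrN.
  exact: le_trans (ler_norm _).
have /choice[p pP] : forall n : nat, exists p,
    (forall t, spectrum (a : A) t%:C%C -> `|f t - p.[t]| <= n.+1%:R^-1) /\
    cnorm (peval a p - (y : A)) <= n.+1%:R^-1.
  by move=> n; have [|p pf py] := fy n.+1%:R^-1; [rewrite invr_gt0|exists p].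
exists p; split.
  move=> P /uniform_nbhs[E [entourE EP]].
  move: entourE; rewrite -entourage_ballE => -[e /= e0 eE].
  have [N NP] := natSinv_lt e0; exists N => // n /= Nn; apply: EP => t at_.
  by apply: eE; rewrite /ball /= (le_lt_trans ((pP n).1 _ at_))// NP.
apply/cvgrPdist_le => e e0; have [N NP] := natSinv_lt e0.
exists N => // n /= Nn; rewrite sub0r normrN ger0_norm ?cnorm_ge0//.
by rewrite (le_trans (pP n).2)// ltW// NP.
Qed.

Lemma cfcP f (a : herm A) :
  (exists2 y, star y = y & fcalc f a y) -> fcalc f a (cfc f a : A).
Proof.
move=> [y yh fy]; apply/is_cfcP; rewrite /cfc; apply: (xgetPex 0).
have yh' : y \in is_herm A by rewrite unfold_in yh.
by exists (Herm yh'); apply/is_cfcP.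
Qed.

Lemma herm_star (a : herm A) : star (a : A) = a.
Proof. exact: eqP (herm_valP a). Qed.

Lemma positiveP (a : herm A) : positive a <-> nonneg (a : A).
Proof.
split=> [pa|na z az].
  apply: spectrum_nonneg; first exact: herm_star.
  by move=> t /pa; rewrite lecR.
have zE := herm_spectrum_real (herm_star a) az; rewrite zE in az *.
by rewrite lecR; exact: nonneg_spectrum az.
Qed.

Lemma herm_leP (a b : herm A) : herm_le a b <-> cle (a : A) b.
Proof. exact: positiveP. Qed.

Lemma cone_posunit (x : cone A) : posunit (x : A).
Proof.
have := cone_valP x; rewrite unfold_in => /andP[/asboolP/positiveP x0 xu].
by split.
Qed.

Lemma sandwich_posunit c x : star c = c -> c \is a GRing.unit -> posunit x ->
  posunit (c * x * c).
Proof.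
move=> ch cu [x0 xu]; split; first exact: nonneg_sandwich_unit.
by rewrite !unitrMr.
Qed.

Lemma cle_sandwich c x y : star c = c -> c \is a GRing.unit -> cle x y ->
  cle (c * x * c) (c * y * c).
Proof.
by move=> ch cu xy; rewrite /cle -mulrBl -mulrBr; exact: nonneg_sandwich_unit.
Qed.

Definition isqrt t := t `^ (- 2^-1) : R.

Lemma isqrt_sqr t : 0 < t -> isqrt t * t * isqrt t = 1.
Proof.
move=> t0; rewrite /isqrt powRN powR12_sqrt ?ltW//.
rewrite -{2}(sqr_sqrtr (ltW t0)) expr2; field.
by rewrite lt0r_neq0// sqrtr_gt0.
Qed.

Lemma poly_approx_isqrt (m M : R) : 0 < m -> poly_approx m M isqrt.
Proof.
move=> m0; apply: (@poly_approx_ext _ _ _ (fun t => (Num.sqrt t)^-1)); last first.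
  move=> t /andP[mt _]; rewrite /isqrt powRN powR12_sqrt//.
  exact: le_trans (ltW m0) mt.
apply: (@poly_approxV _ _ _ m0 _ (Num.sqrt m)); first by rewrite sqrtr_gt0.
  by move=> t /andP[mt _]; rewrite ler_wsqrtr.
apply: (poly_approx_sqrt m0 m0); first by move=> t /andP[].
exact: poly_approx_id.
Qed.

Definition cone_isqrt (x : cone A) : herm A := cfc isqrt x.

Lemma fcalc_cone_isqrt (x : cone A) : fcalc isqrt x (cone_isqrt x : A).
Proof.
by apply: cfcP; apply: fcalc_posunit (cone_posunit x) => m M; exact: poly_approx_isqrt.
Qed.

(** Multiplicativity of the calculus transports the scalar identity. Invertibility of [x^-1/2] and
    the vanishing of [log_at x x] are both read off from it. *)
Lemma cone_isqrtP (x : cone A) : (cone_isqrt x : A) * (x : A) * (cone_isqrt x : A) = 1.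
Proof.
have xh := herm_star (x : herm A); have xc := fcalc_cone_isqrt x.
have := fcalcM xh (fcalcM xh xc (fcalc_id _)) xc.
have [m m0 mx] := posunit_gt0 (cone_posunit x).
move=> /(fcalc_uniq xh) /(_ (fcalcC 1 _)); rewrite rmorph1; apply => t xt.
have /andP[mt _] := posunit_spectrum mx (lexx _) xt.
by rewrite isqrt_sqr// (lt_le_trans m0).
Qed.

(** [c y = c y (c y c) = (c y c) y c = y c], so [y c] is a two-sided inverse. *)
Lemma sandwich1_unit c y : c * y * c = 1 -> c \is a GRing.unit.
Proof.
move=> cyc; have cy : c * y = y * c.
  by rewrite -[LHS]mulr1 -[1 in LHS]cyc !mulrA cyc mul1r.
by apply/unitrP; exists (y * c); split; [rewrite -cy cyc|rewrite mulrA cyc].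
Qed.

Lemma cone_isqrt_unit (x : cone A) : (cone_isqrt x : A) \is a GRing.unit.
Proof. exact: sandwich1_unit (cone_isqrtP x). Qed.

Lemma log_atP (x a : cone A) :
  fcalc (@ln R) ((cone_isqrt x : A) * (a : A) * (cone_isqrt x : A)) (log_at x a : A).
Proof.
apply: (@cfcP _ (sandwich (cone_isqrt x) a)).
apply: fcalc_posunit => [m M|]; first exact: poly_approx_ln.
apply: sandwich_posunit (cone_posunit a); last exact: cone_isqrt_unit.
exact: herm_star.
Qed.

Lemma fcalc_horner f h y q : star h = h -> fcalc f h y ->
  fcalc (fun t => q.[f t]) h (peval y q).
Proof.
move=> hh fy; elim/poly_ind: q => [|q c IH].
  rewrite rmorph0 -(rmorph0 rsc); apply: fcalc_ext (fcalcC _ _) _ => t.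
  by rewrite horner0.
rewrite rmorphD rmorphM /= pevalX pevalC.
by apply: fcalc_ext (fcalcD (fcalcM hh IH fy) (fcalcC _ _)) _ => t; rewrite !hornerE.
Qed.

(** A value [z] for [1 / f] is built by composing approximations of [1 / t] on [[d, C]] with those
    of [f]; multiplicativity and uniqueness then give [y z = 1]. *)
Lemma fcalcV f h y d : star h = h -> star y = y -> fcalc f h y -> 0 < d ->
  (forall t, spectrum h t%:C%C -> d <= f t) ->
  fcalc (fun t => (f t)^-1) h y^-1.
Proof.
move=> hh yh fy d0 df; have dy := fcalc_ge hh yh fy df.
have yp := lower_posunit d0 dy.
have [z zh fz] : exists2 z, star z = z & fcalc (fun t => (f t)^-1) h z.
  apply: fcalc_exists => // e e0.
  have [C C0 fC] := fcalc_bounded hh fy.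
  have e2 : 0 < e / 2 by rewrite divr_gt0.
  have idge t : d <= t <= C -> d <= id t by case/andP.
  have [q qP] := poly_approxV d0 d0 idge (@poly_approx_id _ d C) e2.
  have [p pP _] := fcalc_horner q hh fy e2.
  exists p => t ht; rewrite -[(f t)^-1](subrK q.[f t]) -addrA (splitr e).
  rewrite (le_trans (ler_normD _ _))// lerD ?pP ?qP// df//=.
  exact: le_trans (ler_norm _) (fC _ ht).
have := fcalc_uniq hh (fcalcM hh fy fz) (fcalcC 1 _); rewrite rmorph1.
move=> yz; rewrite -[y^-1]mulr1 -yz ?mulKr//; first by case: yp.
by move=> t /df dt; rewrite divff// lt0r_neq0// (lt_le_trans d0).
Qed.

End FunctionalCalculus.

(** * Monotonicity of the logarithm and the Thompson metric *)

Section LogarithmMonotone.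
Context {R : realType} {A : cstarAlgType R}.
Implicit Types (a b x y z h L : A) (s t e m : R) (n : nat).
Local Notation rsc := (@rscalar R A).

(** The Riemann term [(x - 1) / n] over [1 + s (x - 1)], at [s = (k + 1) / n], is rearranged so that
    [x] occurs once, inside an inverse: monotonicity holds term by term. *)
Definition ln_sumA n x := \sum_(k < n)
  rsc k.+1%:R^-1 * (1 - (1 + rsc (k.+1%:R / n%:R) * (x - 1))^-1).

Lemma cle_segment1 m s x : 0 <= s <= 1 -> cle (rsc m) x ->
  cle (rsc (Num.min 1 m)) (1 + rsc s * (x - 1)).
Proof.
move=> s01 mx; apply: (@cle_trans _ _ _ (1 + rsc s * (rsc m - 1))).
  rewrite -(rmorph1 rsc) -rmorphB -rmorphM -rmorphD; apply: cle_rsc.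
  exact: segment1_ge_min.
apply: cleD; first exact: cle_refl.
apply: cleZ; first by case/andP: s01.
by apply: cleD => //; exact: cle_refl.
Qed.

Lemma segment1_posunit s x : 0 <= s <= 1 -> posunit x ->
  posunit (1 + rsc s * (x - 1)).
Proof.
move=> s01 /posunit_gt0[m m0 mx]; apply: lower_posunit (cle_segment1 s01 mx).
by rewrite lt_min ltr01.
Qed.

Lemma cleN x y : cle x y -> cle (- y) (- x).
Proof. by rewrite /cle opprK addrC. Qed.

Lemma ln_sumA_cle n a b : posunit a -> cle a b -> cle (ln_sumA n a) (ln_sumA n b).
Proof.
move=> ap ab; rewrite /ln_sumA; elim/big_ind2: _ => [|????|k _].
- exact: cle_refl.
- exact: cleD.
have s01 := @natr_div_itv R _ _ (ltn_ord k); have s0 := s01; case/andP: s0 => s0 _.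
apply: cleZ; first by rewrite invr_ge0.
apply: cleD; first exact: cle_refl.
apply/cleN/cle_posunitV; first exact: segment1_posunit.
apply: cleD; first exact: cle_refl.
by apply: cleZ => //; apply: cleD => //; exact: cle_refl.
Qed.

Lemma ln_sumA_herm n x : posunit x -> star (ln_sumA n x) = ln_sumA n x.
Proof.
move=> xp; rewrite /ln_sumA (big_morph _ starD star0); apply: eq_bigr => k _.
have [s0 su] := segment1_posunit (@natr_div_itv R _ _ (ltn_ord k)) xp.
by rewrite starM star_rsc -rscC starB star1 starV// (nonneg_herm s0).
Qed.

(** The factor [t] is moved into the function and the calculus stays in [x], so that
    [ln (t * u) = ln t + ln u] later splits off the scalar [ln t]. *)
Lemma fcalc_ln_sumA n t x : 0 < t -> posunit x ->
  fcalc (fun u => ln_sum n (t * u)) x (ln_sumA n (rsc t * x)).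
Proof.
move=> t0 xp; have xh := nonneg_herm xp.1; have [m m0 mx] := posunit_gt0 xp.
have term (k : 'I_n) : fcalc
    (fun u => k.+1%:R^-1 * (1 + -1 * (1 + k.+1%:R / n%:R * (t * u - 1))^-1)) x
    (rsc k.+1%:R^-1 * (1 + rsc (-1) * (1 + rsc (k.+1%:R / n%:R) * (rsc t * x + rsc (-1)))^-1)).
  have s01 := @natr_div_itv R _ _ (ltn_ord k).
  set s := _ / _ in s01 *.
  apply: (fcalcM xh (fcalcC _ _)).
  have f1 : fcalc (fun=> 1) x 1 by rewrite -[X in fcalc _ _ X](rmorph1 rsc); exact: fcalcC.
  apply: (fcalcD f1).
  apply: (fcalcM xh (fcalcC _ _)); apply: (@fcalcV _ _ _ _ _ (Num.min 1 (t * m))) => //.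
  - rewrite starD star1 starM starD starM xh !star_rsc.
    by rewrite -[x * rsc t]rscC -rscC.
  - apply: (fcalcD f1); apply: (fcalcM xh (fcalcC _ _)).
    apply: fcalcD (fcalcC _ _); exact: (fcalcM xh (fcalcC _ _) (fcalc_id _)).
  - by rewrite lt_min ltr01 mulr_gt0.
  - move=> u xu; have /andP[mu _] := posunit_spectrum mx (lexx _) xu.
    by apply: segment1_ge_min => //; rewrite ler_pM2l.
rewrite /ln_sum /ln_sumA.
have -> : \sum_(k < n) rsc k.+1%:R^-1 * (1 - (1 + rsc (k.+1%:R / n%:R) * (rsc t * x - 1))^-1) =
  \sum_(k < n) (rsc k.+1%:R^-1 * (1 + rsc (-1) * (1 + rsc (k.+1%:R / n%:R) * (rsc t * x + rsc (-1)))^-1)).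
  by apply: eq_bigr => k _; rewrite rmorphN rmorph1 mulN1r.
elim: (index_enum _) => [|k r IH].
  rewrite big_nil -(rmorph0 rsc); apply: fcalc_ext (fcalcC _ _) _ => u _.
  by rewrite big_nil.
rewrite big_cons; apply: fcalc_ext (fcalcD (term k) IH) _ => u _.
by rewrite big_cons mulN1r.
Qed.

Lemma ln_sumA_cvg t x L e : 0 < t -> posunit x ->
  fcalc (fun u => ln (t * u)) x L -> 0 < e ->
  exists N, forall n, (N <= n)%N -> cnorm (L - ln_sumA n.+1 (rsc t * x)) <= e.
Proof.
move=> t0 xp xL e0; have xh := nonneg_herm xp.1; have [m m0 mx] := posunit_gt0 xp.
pose C := (t * cnorm x + 1) ^+ 2 / (t * m) + 1.
have tm0 : 0 < t * m by rewrite mulr_gt0.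
have C0 : 0 < C by rewrite ltr_wpDl// divr_ge0 ?sqr_ge0 ?ltW.
have [N NP] := @natSinv_lt _ (e / C) (divr_gt0 e0 C0).
exists N => n Nn; apply: (fcalc_cnorm xh xL (fcalc_ln_sumA _ t0 xp)) => u xu.
have /andP[mu uM] := posunit_spectrum mx (lexx _) xu.
have tu0 : 0 < t * u by rewrite mulr_gt0// (lt_le_trans m0).
rewrite (le_trans (ln_sum_bound _ tu0))//.
rewrite (@le_trans _ _ (C / n.+1%:R))//; last first.
  by rewrite mulrC -ler_pdivlMr// ltW// NP.
rewrite ler_pM2r ?invr_gt0 ?ltr0n// /C.
rewrite (@le_trans _ _ ((t * cnorm x + 1) ^+ 2 / (t * m))) ?lerDl//.
rewrite ler_pM ?sqr_ge0 ?invr_ge0 ?(ltW tu0)// ?lef_pV2 ?posrE// ?ler_pM2l//.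
have tuM : t * u <= t * cnorm x by rewrite ler_pM2l.
by rewrite -subr_ge0 subr_sqr mulr_ge0//; lra.
Qed.

Lemma ln_cle a b t (La Lb : A) : posunit a -> posunit b -> 0 < t ->
  star La = La -> star Lb = Lb ->
  fcalc (@ln R) a La -> fcalc (@ln R) b Lb -> cle a (rsc t * b) ->
  cle La (Lb + rsc (ln t)).
Proof.
move=> ap bp t0 Lah Lbh fa fb ab; apply: cle_closed => e e0.
have e2 : 0 < e / 2 by rewrite divr_gt0.
have fb' : fcalc (fun u => ln (t * u)) b (Lb + rsc (ln t)).
  apply: fcalc_ext (fcalcD fb (fcalcC _ _)) _ => u bu.
  have [m m0 mb] := posunit_gt0 bp.
  have /andP[mu _] := posunit_spectrum mb (lexx _) bu.
  by rewrite lnM ?posrE// ?(lt_le_trans m0)// addrC.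
have fa' : fcalc (fun u => ln (1 * u)) a La.
  by apply: fcalc_ext fa _ => u _; rewrite mul1r.
have [N NP] := ln_sumA_cvg ltr01 ap fa' e2.
have [N' NP'] := ln_sumA_cvg t0 bp fb' e2.
pose n := maxn N N'.
have h1 : cle La (ln_sumA n.+1 a + rsc (e / 2)).
  have := NP n (leq_maxl _ _); rewrite rmorph1 mul1r => le.
  have := @herm_cle_cnorm _ _ _ _ _ le; rewrite starB Lah ln_sumA_herm//.
  move=> /(_ erefl) h; have := cleD h (cle_refl (ln_sumA n.+1 a)).
  by rewrite subrK addrC.
have h2 : cle (ln_sumA n.+1 (rsc t * b)) (Lb + rsc (ln t) + rsc (e / 2)).
  have := NP' n (leq_maxr _ _); rewrite cnormB => le.
  have := @herm_cle_cnorm _ _ _ _ _ le.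
  rewrite starB starD Lbh star_rsc ln_sumA_herm; last exact: posunitZ.
  move=> /(_ erefl) h.
  by have := cleD h (cle_refl (Lb + rsc (ln t))); rewrite subrK addrC.
apply: (cle_trans h1); rewrite {2}(splitr e) rmorphD [X in cle _ X]addrA.
apply: cleD (cle_refl _); apply: cle_trans h2; exact: ln_sumA_cle.
Qed.

Lemma ln_dist a b t (La Lb : A) : posunit a -> posunit b -> 0 < t ->
  star La = La -> star Lb = Lb ->
  fcalc (@ln R) a La -> fcalc (@ln R) b Lb ->
  cle a (rsc t * b) -> cle b (rsc t * a) -> cnorm (La - Lb) <= ln t.
Proof.
move=> ap bp t0 Lah Lbh fa fb ab ba; apply: cle_cnorm.
  have := cleD (ln_cle ap bp t0 Lah Lbh fa fb ab) (cle_refl (- Lb)).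
  by rewrite addrAC subrr add0r.
have := cleD (ln_cle bp ap t0 Lbh Lah fb fa ba) (cle_refl (- La)).
by rewrite addrAC subrr add0r opprB.
Qed.

End LogarithmMonotone.

(** * Thompson metric and the Lipschitz bound for the logarithm *)

Section ThompsonMetric.
Context {R : realType} {A : cstarAlgType R}.
Implicit Types (x y z a b : cone A) (s t e r : R).
Local Notation rsc := (@rscalar R A).

Let gset x y := [set t : R | 0 < t /\ herm_le (x : herm A) (t *: (y : herm A))].

Let gsetP x y t : gset x y t <-> 0 < t /\ cle (x : A) (rsc t * (y : A)).
Proof.
split=> -[t0 xy]; split=> //.
  by move/herm_leP : xy; rewrite /= rsc_scale.
by apply/herm_leP; rewrite /= rsc_scale.
Qed.

Lemma cone_upper x : exists2 M, 0 < M & cle (x : A) (rsc M).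
Proof.
exists (cnorm (x : A) + 1); first by rewrite ltr_wpDl ?cnorm_ge0.
by apply: herm_cle_cnorm; rewrite ?herm_star// lerDl.
Qed.

Lemma cone_lower x : exists2 m, 0 < m & cle (rsc m) (x : A).
Proof. exact/posunit_gt0/cone_posunit. Qed.

Lemma rsc_cle s t : cle (rsc s : A) (rsc t) -> s <= t.
Proof.
move=> st; rewrite -subr_ge0; apply: nonneg_spectrum st _.
by rewrite spectrum_rsc rmorphB subrr unitr0.
Qed.

Let gset_nonempty x y : gset x y !=set0.
Proof.
have [M M0 xM] := cone_upper x; have [m m0 my] := cone_lower y.
exists (M / m); apply/gsetP; split; first by rewrite divr_gt0.
apply: (cle_trans xM); have := @cleZ _ _ (M / m) _ _ _ my.
by rewrite -rmorphM divfK ?lt0r_neq0//; apply; rewrite divr_ge0 ?ltW.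
Qed.

Let gset_lb x y : lbound (gset x y) 0.
Proof. by move=> t [/ltW]. Qed.

Let gset_inf x y : has_inf (gset x y).
Proof. by split; [exact: gset_nonempty|exists 0; exact: gset_lb]. Qed.

(** Strictly above the infimum some smaller admissible number exists, and admissibility passes
    upwards since [y] is positive. Later estimates carry a slack [e] in order to stay in this
    range. *)
Lemma gauge_lt x y t : gauge x y < t -> 0 < t /\ cle (x : A) (rsc t * (y : A)).
Proof.
move=> /(inf_lt (gset_nonempty x y))[s /gsetP[s0 xs] st]; split; first exact: lt_trans st.
apply: (cle_trans xs); rewrite /cle -mulrBl -rmorphB; apply: nonnegZ.
  by rewrite subr_ge0 ltW.
by case: (cone_posunit y).
Qed.

Lemma gauge_le x y t : 0 < t -> cle (x : A) (rsc t * (y : A)) -> gauge x y <= t.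
Proof. by move=> t0 xy; apply: (ge_inf (gset_inf x y).2); exact/gsetP. Qed.

Lemma gauge_gt0 x y : 0 < gauge x y.
Proof.
have [M M0 yM] := cone_upper y; have [m m0 mx] := cone_lower x.
apply: (@lt_le_trans _ _ (m / M)); first by rewrite divr_gt0.
apply: lb_le_inf; first exact: gset_nonempty.
move=> t /gsetP[t0 xy]; rewrite ler_pdivrMr//; apply: rsc_cle.
rewrite rmorphM; apply: (cle_trans mx); apply: (cle_trans xy).
by apply: cleZ => //; exact: ltW.
Qed.

Definition thompsonR x y : R := ln (Num.max (gauge x y) (gauge y x)).

Lemma thompsonE x y : thompson A x y = (thompsonR x y)%:E.
Proof. by []. Qed.

Let max_gt0 x y : 0 < Num.max (gauge x y) (gauge y x).
Proof. by rewrite lt_max gauge_gt0. Qed.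

Lemma thompson_lt x y r : thompsonR x y < r ->
  cle (x : A) (rsc (expR r) * (y : A)) /\ cle (y : A) (rsc (expR r) * (x : A)).
Proof.
rewrite -ltr_expR lnK ?posrE// gt_max => /andP[xy yx].
by split; [have [] := gauge_lt xy|have [] := gauge_lt yx].
Qed.

Lemma thompson_le x y r :
  cle (x : A) (rsc (expR r) * (y : A)) -> cle (y : A) (rsc (expR r) * (x : A)) ->
  thompsonR x y <= r.
Proof.
move=> xy yx; rewrite -ler_expR lnK ?posrE// ge_max.
by rewrite !gauge_le// expR_gt0.
Qed.

Lemma thompson_sym x y : thompsonR x y = thompsonR y x.
Proof. by rewrite /thompsonR maxC. Qed.

Lemma thompson_tri x y z : thompsonR x z <= thompsonR x y + thompsonR y z.
Proof.
apply/ler_addgt0Pl => e e0; have e2 : 0 < e / 2 by rewrite divr_gt0.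
have [|xy yx] := @thompson_lt x y (thompsonR x y + e / 2); first by rewrite ltrDl.
have [|yz zy] := @thompson_lt y z (thompsonR y z + e / 2); first by rewrite ltrDl.
have -> : e + (thompsonR x y + thompsonR y z) =
    thompsonR x y + e / 2 + (thompsonR y z + e / 2) by field.
move: (_ + e / 2) (_ + e / 2) xy yx yz zy => r1 r2 xy yx yz zy.
apply: thompson_le.
  apply: (cle_trans xy); rewrite expRD rmorphM -mulrA.
  by apply: cleZ yz; exact: expR_ge0.
apply: (cle_trans zy); rewrite addrC expRD rmorphM -mulrA.
by apply: cleZ yx; exact: expR_ge0.
Qed.

Lemma thompson_refl x : thompsonR x x = 0.
Proof.
have gx : gauge x x = 1.
  apply/eqP; rewrite eq_le gauge_le ?rmorph1 ?mul1r//=; last exact: cle_refl.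
  (* The midpoint [t] lies strictly between the gauge and 1; [x <= t x] would give [(1 - t) m <= 0]
     for a positive lower bound [m] of [x]. *)
  rewrite leNgt; apply/negP => g1; pose t := (1 + gauge x x) / 2.
  have [|_ xt] := @gauge_lt x x t; first by rewrite /t; lra.
  have [m m0 mx] := cone_lower x.
  have t1 : 0 < 1 - t by rewrite /t; lra.
  have : cle (rsc ((1 - t) * m)) (rsc 0).
    rewrite rmorphM; apply: (cle_trans (cleZ (ltW t1) mx)).
    rewrite rmorphB rmorph1 mulrBl mul1r rmorph0 -(subrr (rsc t * (x : A))).
    by apply: cleD xt (cle_refl _).
  by move=> /rsc_cle; rewrite leNgt mulr_gt0.
by rewrite /thompsonR gx maxxx ln1.
Qed.

Lemma thompson_ge0 x y : 0 <= thompsonR x y.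
Proof.
have := thompson_tri x y x; rewrite thompson_refl [thompsonR y x]thompson_sym.
lra.
Qed.

Lemma log_at_dist x a b : `|log_at x a - log_at x b| <= thompsonR a b.
Proof.
apply/ler_addgt0Pr => e e0.
have [|ab ba] := @thompson_lt a b (thompsonR a b + e); first by rewrite ltrDl.
have ch := herm_star (cone_isqrt x); have cu := cone_isqrt_unit x.
rewrite -[leRHS]expRK; change (cnorm ((log_at x a : A) - (log_at x b : A)) <=
  ln (expR (thompsonR a b + e))).
apply: (ln_dist _ _ _ _ _ (log_atP x a) (log_atP x b)).
- exact: sandwich_posunit (cone_posunit a).
- exact: sandwich_posunit (cone_posunit b).
- exact: expR_gt0.
- exact: herm_star.
- exact: herm_star.
- have := cle_sandwich ch cu ab; rewrite [X in cle _ (X * _)]mulrA -[_ * rsc _]rscC.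
  by rewrite -!mulrA.
- have := cle_sandwich ch cu ba; rewrite [X in cle _ (X * _)]mulrA -[_ * rsc _]rscC.
  by rewrite -!mulrA.
Qed.

Lemma log_at_self x : log_at x x = 0.
Proof.
apply: val_inj => /=; have := log_atP x x; rewrite cone_isqrtP => l.
rewrite -(rmorph0 rsc); apply: (fcalc_uniq star1 l (fcalcC 0 _)) => t.
rewrite spectrum_rsc -(rmorph1 rsc) -rmorphB; have [->|t1] := eqVneq t 1.
  by rewrite ln1.
by rewrite rsc_unit// subr_eq0.
Qed.

Lemma log_at_norm x a : `|log_at x a| <= thompsonR x a.
Proof.
by have := log_at_dist x a x; rewrite log_at_self subr0 thompson_sym.
Qed.


End ThompsonMetric.

(** * Norm continuity of the functional calculus and of the base point *)

Section LogAtContinuity.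
Context {R : realType} {A : cstarAlgType R}.
Local Notation rsc := (@rscalar R A).

Lemma peval_cont (x : A) (p : {poly R}) (e : R) : 0 < e ->
  exists2 d : R, 0 < d & forall y : A, cnorm (y - x) < d ->
    cnorm (peval y p - peval x p) <= e.
Proof.
elim/poly_ind: p e => [|q c IH] e e0.
  by exists 1 => // y _; rewrite !rmorph0 subrr cnorm0 ltW.
pose X := cnorm x + 1; have X0 : 0 < X by rewrite ltr_wpDl ?cnorm_ge0.
pose Q := cnorm (peval x q) + 1; have Q0 : 0 < Q by rewrite ltr_wpDl ?cnorm_ge0.
have [|d d0 dP] := IH (e / 2 / X); first by rewrite !divr_gt0.
exists (Num.min 1 (Num.min d (e / 2 / Q))).
  by rewrite !lt_min ltr01 d0 !divr_gt0.
move=> y; rewrite !lt_min => /andP[y1 /andP[yd yQ]].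
rewrite !rmorphD !rmorphM /= !pevalX !pevalC opprD addrACA subrr addr0.
have yX : cnorm y <= X.
  by rewrite -(subrK x y) addrC (le_trans (cnormD _ _))// lerD2l ltW.
have -> : peval y q * y - peval x q * x =
    (peval y q - peval x q) * y + peval x q * (y - x).
  by rewrite mulrBl mulrBr addrA subrK.
rewrite (le_trans (cnormD _ _))// (splitr e) lerD//.
  rewrite (le_trans (cnormM _ _))// -[leRHS](mulfVK (lt0r_neq0 X0)).
  by rewrite ler_pM ?cnorm_ge0 ?dP.
rewrite (le_trans (cnormM _ _))// -[leRHS](mulfVK (lt0r_neq0 Q0)) mulrC.
by rewrite ler_pM ?cnorm_ge0 ?(ltW yQ)// lerDl.
Qed.

(** If [x >= m], every [y] near [x] has its spectrum in [[m / 2, |x| + 1]], so a single polynomial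
    approximates [f] on all these spectra, and polynomials are norm continuous. *)
Lemma fcalc_cont (f : R -> R) (x u : A) (e : R) :
  (forall m M : R, 0 < m -> poly_approx m M f) -> posunit x -> fcalc f x u ->
  0 < e -> exists2 d : R, 0 < d & forall y v : A, posunit y -> fcalc f y v ->
    cnorm (y - x) < d -> cnorm (v - u) <= e.
Proof.
move=> fa xp fu e0; have [m m0 mx] := posunit_gt0 xp.
have m2 : 0 < m / 2 by rewrite divr_gt0.
have e4 : 0 < e / 4 by rewrite divr_gt0.
pose M := cnorm x + 1; have [p pP] := fa _ M m2 _ e4.
have [d d0 dP] := peval_cont x p e4.
exists (Num.min 1 (Num.min d (m / 2))); first by rewrite !lt_min ltr01 d0.
move=> y v yp fv; rewrite !lt_min => /andP[y1 /andP[yd ym]].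
have yM : cnorm y <= M.
  by rewrite -(subrK x y) addrC (le_trans (cnormD _ _))// lerD2l ltW.
have xM : cnorm x <= M by rewrite lerDl.
have mx' : cle (rsc (m / 2)) x.
  by apply: cle_trans mx; apply: cle_rsc; lra.
have my : cle (rsc (m / 2)) y.
  have xy : cle x (y + rsc (m / 2)).
    have := @herm_cle_cnorm _ _ (x - y) (m / 2).
    rewrite starB !nonneg_herm//; try (by case: xp); try (by case: yp).
    rewrite cnormB => /(_ erefl (ltW ym)) h.
    by have := cleD h (cle_refl y); rewrite subrK addrC.
  have := cleD (cle_trans mx xy) (cle_refl (- rsc (m / 2))).
  by rewrite addrK -rmorphB (_ : m - m / 2 = m / 2)//; field.
have hv : cnorm (v - peval y p) <= e / 4.
  apply: (fcalc_cnorm (nonneg_herm yp.1) fv (fcalc_peval _ _)) => t yt.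
  by apply: pP; exact: posunit_spectrum yt.
have hu : cnorm (u - peval x p) <= e / 4.
  apply: (fcalc_cnorm (nonneg_herm xp.1) fu (fcalc_peval _ _)) => t xt.
  by apply: pP; exact: posunit_spectrum xt.
have := cnorm_tri v (peval y p) u; have := cnorm_tri (peval y p) (peval x p) u.
by have := dP _ yd; move: hu; rewrite cnormB; lra.
Qed.

(** On the ball of radius [ln (1 + k)], [y - x <= k x] and [x - y <= k y <= k (1 + k) x]. With
    [k <= 1] both are at most [2 k X], and [k] is chosen to make this at most [e / 2]. *)
Lemma thompson_cnorm (x : cone A) (e : R) : 0 < e ->
  exists2 d : R, 0 < d & forall y : cone A, thompsonR x y < d ->
    cnorm ((y : A) - (x : A)) < e.
Proof.
move=> e0; pose X := cnorm (x : A) + 1.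
have X0 : 0 < X by rewrite ltr_wpDl ?cnorm_ge0.
pose k := Num.min 1 (e / (4 * X)).
have k0 : 0 < k by rewrite lt_min ltr01 divr_gt0// mulr_gt0.
have k1 : k <= 1 by rewrite ge_min lexx.
have kX : k * (4 * X) <= e by rewrite -ler_pdivlMr ?mulr_gt0// ge_min lexx orbT.
have k10 : 0 < 1 + k by rewrite addr_gt0.
exists (ln (1 + k)) => [|y /thompson_lt].
  by rewrite ln_gt0// ltrDl.
rewrite lnK ?posrE// => -[xy yx].
have xX : cle (x : A) (rsc X) by apply: herm_cle_cnorm; rewrite ?herm_star// lerDl.
have h1 : cle ((y : A) - (x : A)) (rsc (k * X)).
  have := cleD yx (cle_refl (- (x : A))); rewrite rmorphD rmorph1 mulrDl mul1r.
  rewrite [X in cle _ X]addrAC subrr add0r => /cle_trans; apply.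
  by rewrite rmorphM; exact: cleZ (ltW k0) xX.
have h2 : cle (- ((y : A) - (x : A))) (rsc (k * (1 + k) * X)).
  have := cleD xy (cle_refl (- (y : A))); rewrite rmorphD rmorph1 mulrDl mul1r.
  rewrite opprB [X in cle _ X]addrAC subrr add0r => /cle_trans; apply.
  rewrite -mulrA rmorphM; apply: cleZ; first exact: ltW.
  apply: (cle_trans yx); rewrite rmorphM rmorphD rmorph1.
  by rewrite -(rmorph1 rsc) -rmorphD; exact: cleZ (ltW k10) xX.
have kX0 : 0 < k * X by rewrite mulr_gt0.
apply: (@le_lt_trans _ _ (k * 2 * X)); last by lra.
apply: cle_cnorm.
  by apply: (cle_trans h1); apply: cle_rsc; lra.
by apply: (cle_trans h2); apply: cle_rsc; nra.
Qed.

Lemma log_at_cont (x a : cone A) (e : R) : 0 < e ->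
  exists2 d : R, 0 < d & forall y : cone A, thompsonR x y < d ->
    `|log_at y a - log_at x a| <= e.
Proof.
move=> e0; set c := cone_isqrt x : A.
have pu (y : cone A) : posunit ((cone_isqrt y : A) * (a : A) * (cone_isqrt y : A)).
  apply: sandwich_posunit (cone_posunit a); last exact: cone_isqrt_unit.
  exact: herm_star.
have [d1 d10 d1P] := fcalc_cont (fun m M => @poly_approx_ln R m M) (pu x) (log_atP x a) e0.
(* For [b] within [k <= 1] of [c], the difference [b a b - c a c = (b - c) a b + c a (b - c)] has
   norm at most [k (C - 1)]. *)
pose C := cnorm (a : A) * (2 * cnorm c + 1) + 1.
have C0 : 0 < C.
  by rewrite ltr_wpDl// mulr_ge0 ?cnorm_ge0// addr_ge0// mulr_ge0 ?cnorm_ge0.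
pose k := Num.min 1 (d1 / (2 * C)).
have k0 : 0 < k by rewrite lt_min ltr01 divr_gt0// mulr_gt0.
have k1 : k <= 1 by rewrite ge_min lexx.
have kC : k * (2 * C) <= d1 by rewrite -ler_pdivlMr ?mulr_gt0// ge_min lexx orbT.
have [d2 d20 d2P] := fcalc_cont (@poly_approx_isqrt R) (cone_posunit x)
  (fcalc_cone_isqrt x) k0.
have [d d0 dP] := thompson_cnorm x d20.
exists d => // y /dP/(d2P _ _ (cone_posunit y) (fcalc_cone_isqrt y)) yc.
apply: d1P (pu y) (log_atP y a) _.
rewrite -/c in yc *; set b := cone_isqrt y : A in yc *.
have bc : cnorm b <= cnorm c + k.
  by rewrite -(subrK c b) addrC (le_trans (cnormD _ _))// lerD2l.
have -> : b * (a : A) * b - c * (a : A) * c = (b - c) * ((a : A) * b) + c * ((a : A) * (b - c)).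
  by rewrite mulrBl !mulrBr !mulrA addrA subrK.
have h1 : cnorm ((b - c) * ((a : A) * b)) <= k * (cnorm (a : A) * (cnorm c + 1)).
  rewrite (le_trans (cnormM _ _))// ler_pM ?cnorm_ge0//.
  rewrite (le_trans (cnormM _ _))// ler_wpM2l ?cnorm_ge0//.
  by rewrite (le_trans bc)// lerD2l.
have h2 : cnorm (c * ((a : A) * (b - c))) <= k * (cnorm (a : A) * cnorm c).
  rewrite (le_trans (cnormM _ _))// [leRHS]mulrC [_ * cnorm c]mulrC -mulrA.
  rewrite ler_wpM2l ?cnorm_ge0// (le_trans (cnormM _ _))//.
  by rewrite ler_wpM2l ?cnorm_ge0.
rewrite (le_lt_trans (cnormD _ _))// (le_lt_trans (lerD h1 h2))//.
rewrite (lt_le_trans _ kC)// -mulrDr ltr_pM2l// /C.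
have := mulr_ge0 (cnorm_ge0 (a : A)) (cnorm_ge0 c); have := cnorm_ge0 (a : A); lra.
Qed.

End LogAtContinuity.

(** * Bochner integrals *)

Section SimpleFunctions.
Context {d : measure_display} {T : measurableType d} {R : realType}.
Context (mu : {finite_measure set T -> \bar R}).

Lemma integral_fibers (W : choiceType) (phi : T -> W) (P : seq W) (g : W -> R) :
  uniq P -> (forall x, phi x \in P) ->
  (forall p, measurable (phi @^-1` [set p])) -> (forall p, 0 <= g p) ->
  (\int[mu]_x (g (phi x))%:E =
   \sum_(p <- P) (g p)%:E * mu (phi @^-1` [set p]))%E.
Proof.
move=> uP phiP mphi g0.
transitivity (\int[mu]_x \sum_(p <- P) (g p)%:E * (\1_(phi @^-1` [set p]) x)%:E)%E.
  apply: eq_integral => x _; rewrite (bigD1_seq (phi x))//= big1_seq.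
    by rewrite adde0 indicE mem_set// mule1.
  by move=> p /andP[pP _]; rewrite indicE memNset ?mule0//=; apply/nesym/eqP.
rewrite ge0_integral_sum//.
- apply: eq_bigr => p _; rewrite ge0_integralZl_EFin//.
  + by rewrite integral_indic// setIT.
  + exact/measurable_EFinP/measurable_indic.
- move=> p; apply: measurable_funeM; exact/measurable_EFinP/measurable_indic.
- by move=> p x _; rewrite mule_ge0// lee_fin.
Qed.

(** The sum over the range of [s] is recomputed along any finite measurable partition on which [s]
    is constant, so that several simple functions can share one partition. *)
Lemma simple_integral_fibers (V : normedModType R) (W : choiceType) (phi : T -> W)
    (P : seq W) (h : W -> V) (s : T -> V) :
  uniq P -> (forall x, phi x \in P) ->
  (forall p, measurable (phi @^-1` [set p])) -> (forall x, s x = h (phi x)) ->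
  simple_integral mu s = \sum_(p <- P) fine (mu (phi @^-1` [set p])) *: h p.
Proof.
move=> uP phiP mphi sE.
have muE v : fine (mu (s @^-1` [set v])) =
    \sum_(p <- P | h p == v) fine (mu (phi @^-1` [set p])).
  have ms : measurable (s @^-1` [set v]).
    rewrite (_ : _ @^-1` _ = \big[setU/set0]_(p <- P | h p == v) (phi @^-1` [set p])).
      exact: bigsetU_measurable.
    rewrite -bigcup_seq_cond; apply/seteqP; split=> x /=.
      by move=> sxv; exists (phi x) => //=; rewrite phiP -sE sxv eqxx.
    by case=> p /= /andP[_ /eqP hp] xp; rewrite sE xp.
  have := @integral_fibers _ phi P (fun p => (h p == v)%:R) uP phiP mphi.
  have -> : (\int[mu]_x (h (phi x) == v)%:R%:E = mu (s @^-1` [set v]))%E.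
    rewrite -[in RHS](setIT (s @^-1` _)) -integral_indic//.
    apply: eq_integral => x _; rewrite indicE -sE; congr ((nat_of_bool _)%:R%:E).
    by apply/eqP/idP; rewrite inE.
  move=> -> //.
  rewrite -sum_fine; last by move=> p _; rewrite fin_numM// fin_num_measure.
  rewrite [RHS]big_mkcond /=; apply: eq_bigr => p _; case: ifP => _.
    by rewrite mul1e.
  by rewrite mul0e.
(* A fibre of [phi] may be empty, and then [h p] may lie outside the range of [s]; such extra values
   have empty preimages and contribute nothing. *)
rewrite /simple_integral (fsbig_fwiden (undup [seq h p | p <- P]))//.
- rewrite (eq_bigr _ (fun v _ => congr1 ( *:%R^~ v) (muE v))).
  under eq_bigr do rewrite scaler_suml.
  rewrite (exchange_big_dep xpredT)//=; apply: eq_big_seq => p pP.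
  rewrite big_mkcond (bigD1_seq (h p))//= ?mem_undup ?map_f ?undup_uniq//.
  by rewrite eqxx big1 ?addr0// => v /negPf; rewrite eq_sym => ->.
- by move=> _ [x _ <-] /=; rewrite mem_undup sE map_f.
- exact: undup_uniq.
- move=> v [_ /= vs]; rewrite (_ : _ @^-1` _ = set0) ?measure0 ?scale0r//.
  by rewrite -subset0 => x /= sx; apply: vs; exists x.
Qed.

Lemma simple_fun_seq (V : normedModType R) (s : T -> V) : simple_fun s ->
  exists2 P : seq V, uniq P & forall x, s x \in P.
Proof.
move=> [/finite_seqP[P sP] _]; exists (undup P); first exact: undup_uniq.
move=> x; rewrite mem_undup; have : range s (s x) by exists x.
by rewrite sP.
Qed.

End SimpleFunctions.

Lemma simple_integral_pullback (R : realType) (V : normedModType R)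
    (dT dZ : measure_display) (T : measurableType dT) (Z : measurableType dZ)
    (mu : {finite_measure set T -> \bar R}) (pi : {finite_measure set Z -> \bar R})
    (phi : Z -> T) (s : T -> V) :
  measurable_fun setT phi ->
  (forall B, measurable B -> pi (phi @^-1` B) = mu B) ->
  simple_fun s -> simple_integral mu s = simple_integral pi (s \o phi).
Proof.
move=> mphi phi_mu fs; have [P uP sP] := simple_fun_seq fs; have ms := fs.2.
rewrite (@simple_integral_fibers _ _ _ mu _ _ s P id)//.
rewrite (@simple_integral_fibers _ _ _ pi _ _ (s \o phi) P id)//.
- by apply: eq_bigr => v _; rewrite [in RHS]comp_preimage phi_mu.
- by move=> x; exact: sP.
- by move=> v; rewrite comp_preimage -[X in measurable X]setTI; exact: mphi.
Qed.

Lemma simple_fun_pullback (R : realType) (V : normedModType R)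
    (dT dZ : measure_display) (T : measurableType dT) (Z : measurableType dZ)
    (phi : Z -> T) (s : T -> V) :
  measurable_fun setT phi -> simple_fun s -> simple_fun (s \o phi).
Proof.
move=> mphi [fs ms]; split.
  by apply: sub_finite_set fs => _ [x _ <-]; exists (phi x).
by move=> v; rewrite comp_preimage -[X in measurable X]setTI; exact: mphi.
Qed.

Section SimpleEstimate.
Context {R : realType} {V : normedModType R}.
Context {d : measure_display} {T : measurableType d}.
Implicit Types (s t : T -> V) (f g : T -> V).

(** The pair [(s x, t x)] takes finitely many values, and on the partition that it defines the two
    sums subtract term by term. *)
Lemma simple_integral_dist (mu : {finite_measure set T -> \bar R}) s t :
  simple_fun s -> simple_fun t ->
  (`|simple_integral mu s - simple_integral mu t|%:E <=
   \int[mu]_x `|s x - t x|%:E)%E.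
Proof.
move=> fs ft; have [P uP sP] := simple_fun_seq fs.
have [Q uQ tQ] := simple_fun_seq ft.
pose PQ := [seq (v, w) | v <- P, w <- Q]; pose st x := (s x, t x).
have uPQ : uniq PQ by apply: allpairs_uniq => // -[? ?] [? ?] _ _ [-> ->].
have stPQ x : st x \in PQ by apply: allpairs_f.
have mst p : measurable (st @^-1` [set p]).
  rewrite (_ : _ @^-1` _ = s @^-1` [set p.1] `&` t @^-1` [set p.2]).
    by apply: measurableI; [exact: fs.2|exact: ft.2].
  apply/seteqP; split=> x /=; first by case: p => ? ? [-> ->].
  by case: p => ? ? [/= <- <-].
rewrite (simple_integral_fibers mu (W := (V * V)%type) uPQ stPQ mst (h := fst))//.
rewrite (simple_integral_fibers mu (W := (V * V)%type) uPQ stPQ mst (h := snd))//.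
rewrite (@integral_fibers _ _ _ mu (V * V)%type st PQ (fun p => `|p.1 - p.2|))//.
rewrite -sumrB (le_trans _ (_ : (\sum_(p <- PQ) `|fine (mu (st @^-1` [set p])) *: p.1 -
  fine (mu (st @^-1` [set p])) *: p.2|)%:E <= _)%E)//.
  by rewrite lee_fin ler_norm_sum.
rewrite -sumEFin; apply: lee_sum => p _.
rewrite -scalerBr normrZ ger0_norm ?fine_ge0 ?measure_ge0//.
by rewrite EFinM fineK ?fin_num_measure// muleC.
Qed.

(* Norm-measurability replaces Borel measurability of V-valued maps, whose
   sums need not be Borel when V is not separable. *)
Definition norm_measurable f := forall v : V, measurable_fun setT (fun x => `|f x - v|).

Lemma measurable_dist_simple f s : norm_measurable f -> simple_fun s ->
  measurable_fun setT (fun x => `|f x - s x|).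
Proof.
move=> mf fs; have [P uP sP] := simple_fun_seq fs.
rewrite (_ : (fun x => _) = fun x => \sum_(v <- P) `|f x - v| * \1_(s @^-1` [set v]) x).
  apply: measurable_sum => v; apply: measurable_funM; first exact: mf.
  by apply: measurable_indic; exact: fs.2.
apply/funext => x; rewrite (bigD1_seq (s x))//= big1_seq.
  by rewrite addr0 indicE mem_set// mulr1.
by move=> v /andP[vs _]; rewrite indicE memNset ?mulr0//=; apply/nesym/eqP.
Qed.

Lemma simple_fun_norm_measurable s : simple_fun s -> norm_measurable s.
Proof.
move=> fs v; have [P uP sP] := simple_fun_seq fs.
rewrite (_ : (fun x => _) = fun x => \sum_(w <- P) `|w - v| * \1_(s @^-1` [set w]) x).
  apply: measurable_sum => w; apply: measurable_funM; first exact: measurable_cst.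
  by apply: measurable_indic; exact: fs.2.
apply/funext => x; rewrite (bigD1_seq (s x))//= big1_seq.
  by rewrite addr0 indicE mem_set// mulr1.
by move=> w /andP[ws _]; rewrite indicE memNset ?mulr0//=; apply/nesym/eqP.
Qed.

End SimpleEstimate.

Section BochnerEstimate.
Context {R : realType}.

Lemma cvge0_lt (u : nat -> \bar R) (e : R) : u n @[n --> \oo] --> 0%E -> 0 < e ->
  exists N : nat, forall n, (N <= n)%N -> (u n < e%:E)%E.
Proof.
move=> /fine_cvgP[[N1 _ N1P] /cvgrPdist_lt] ue e0.
have [N2 _ N2P] := ue _ e0; exists (maxn N1 N2) => n nN.
have un : u n \is a fin_num by apply: N1P; exact: leq_trans (leq_maxl _ _) nN.
rewrite -(fineK un) lte_fin (le_lt_trans (ler_norm _))// -normrN -[- _]add0r.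
by apply: N2P; exact: leq_trans (leq_maxr _ _) nN.
Qed.

Lemma integral_pullback (dT dZ : measure_display) (T : measurableType dT)
    (Z : measurableType dZ) (mu : {measure set T -> \bar R})
    (pi : {measure set Z -> \bar R}) (phi : Z -> T) (F : T -> \bar R) :
  measurable_fun setT phi ->
  (forall B, measurable B -> pi (phi @^-1` B) = mu B) ->
  measurable_fun setT F -> (forall x, (0 <= F x)%E) ->
  (\int[pi]_z F (phi z) = \int[mu]_x F x)%E.
Proof.
move=> mphi phi_mu mF F0.
rewrite -(@ge0_integral_pushforward _ _ _ _ _ phi mphi pi setT F)//.
by apply: eq_measure_integral => B mB _; rewrite -phi_mu.
Qed.

Context {V : normedModType R}.
Context {dT dU dZ : measure_display} {T : measurableType dT}
  {U : measurableType dU} {Z : measurableType dZ}.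
Context (mu : {finite_measure set T -> \bar R})
  (nu : {finite_measure set U -> \bar R}) (pi : {finite_measure set Z -> \bar R}).

(** Both simple integrals are pulled back to [Z]. Identity maps with [f = g] give the Cauchy
    property of the integrals, identity maps with [f] and [g] different compare two integrands, and
    the projections of a coupling compare two measures. *)
Lemma bochner_dist (phi : Z -> T) (psi : Z -> U) (f : T -> V) (g : U -> V)
    (s : nat -> T -> V) (t : nat -> U -> V) (n m : nat) :
  measurable_fun setT phi -> measurable_fun setT psi ->
  (forall B, measurable B -> pi (phi @^-1` B) = mu B) ->
  (forall B, measurable B -> pi (psi @^-1` B) = nu B) ->
  norm_measurable f -> norm_measurable g ->
  measurable_fun setT (fun z => `|f (phi z) - g (psi z)|) ->
  bochner_approx mu f s -> bochner_approx nu g t ->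
  (`|simple_integral mu (s n) - simple_integral nu (t m)|%:E <=
   \int[mu]_x `|f x - s n x|%:E + \int[pi]_z `|f (phi z) - g (psi z)|%:E +
   \int[nu]_y `|g y - t m y|%:E)%E.
Proof.
move=> mphi mpsi phi_mu psi_nu mf mg mfg [fs _ _] [ft _ _].
rewrite (simple_integral_pullback mphi phi_mu (fs n)).
rewrite (simple_integral_pullback mpsi psi_nu (ft m)).
have fs' := simple_fun_pullback mphi (fs n).
have ft' := simple_fun_pullback mpsi (ft m).
rewrite (le_trans (simple_integral_dist pi fs' ft'))//.
have m1 : measurable_fun setT (fun x => `|f x - s n x|%:E).
  by apply/measurable_EFinP; exact: measurable_dist_simple.
have m2 : measurable_fun setT (fun y => `|g y - t m y|%:E).
  by apply/measurable_EFinP; exact: measurable_dist_simple.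
have m1' : measurable_fun setT (fun z => `|f (phi z) - s n (phi z)|%:E).
  exact: (measurableT_comp m1 mphi).
have m2' : measurable_fun setT (fun z => `|g (psi z) - t m (psi z)|%:E).
  exact: (measurableT_comp m2 mpsi).
have m3' : measurable_fun setT (fun z => `|f (phi z) - g (psi z)|%:E).
  exact/measurable_EFinP.
rewrite -(integral_pullback mphi phi_mu m1)//.
rewrite -(integral_pullback mpsi psi_nu m2)//.
rewrite -ge0_integralD// -ge0_integralD//; last 2 first.
- by move=> z _; rewrite adde_ge0.
- exact: emeasurable_funD.
apply: ge0_le_integral => //.
- apply/measurable_EFinP; apply: measurable_dist_simple ft'.
  exact: simple_fun_norm_measurable.
- by apply: emeasurable_funD => //; exact: emeasurable_funD.
- move=> z _; rewrite -!EFinD lee_fin /=.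
  have -> : s n (phi z) - t m (psi z) = - (f (phi z) - s n (phi z)) +
      (f (phi z) - g (psi z)) + (g (psi z) - t m (psi z)).
    by rewrite opprB !subrKA.
  by rewrite (le_trans (ler_normD _ _))// lerD// (le_trans (ler_normD _ _))// normrN.
Qed.

End BochnerEstimate.

Section BochnerIntegral.
Context {R : realType} {V : normedModType R}.
Hypothesis V_complete : forall u : nat -> V,
  (forall e : R, 0 < e -> exists N : nat, forall m n : nat,
      (N <= m)%N -> (N <= n)%N -> `|u m - u n| < e) -> cvgn u.

(** [bochner_integral] picks a limit, with default [0]. Completeness shows that a limit exists, and
    the one picked comes with its own approximating sequence, which is the one returned. *)
Lemma bochner_integral_approx (d : measure_display) (T : measurableType d)
    (mu : {finite_measure set T -> \bar R}) (f : T -> V) :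
  norm_measurable f -> bochner_integrable mu f ->
  exists2 s, bochner_approx mu f s &
    simple_integral mu (s n) @[n --> \oo] --> bochner_integral mu f.
Proof.
move=> mf [s fs].
have /cvg_ex[I sI] : cvgn (fun n => simple_integral mu (s n)).
  apply: V_complete => e e0; have [_ _ s0] := fs.
  have e2 : 0 < e / 2 by rewrite divr_gt0.
  have [N NP] := cvge0_lt s0 e2; exists N => m n Nm Nn.
  rewrite -lte_fin.
  have := @bochner_dist _ _ _ _ _ _ _ _ mu mu mu id id f f s s m n
    (@measurable_id _ _ _) (@measurable_id _ _ _) (fun B _ => erefl) (fun B _ => erefl) mf mf.
  move=> /(_ _ fs fs) /le_lt_trans -> //.
    by under eq_fun do rewrite subrr normr0; exact: measurable_cst.
  have -> : (\int[mu]_z `|f (id z) - f (id z)|%:E = 0)%E.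
    by under eq_integral do rewrite subrr normr0; rewrite integral0.
  by rewrite adde0 (splitr e) EFinD lteD ?NP.
have : [set I | exists2 s, bochner_approx mu f s &
    simple_integral mu (s n) @[n --> \oo] --> I] (bochner_integral mu f).
  by apply: (xgetPex 0); exists I, s.
by [].
Qed.

Lemma bochner_integral_dist (dT dU dZ : measure_display)
    (T : measurableType dT) (U : measurableType dU) (Z : measurableType dZ)
    (mu : {finite_measure set T -> \bar R}) (nu : {finite_measure set U -> \bar R})
    (pi : {finite_measure set Z -> \bar R}) (phi : Z -> T) (psi : Z -> U)
    (f : T -> V) (g : U -> V) :
  measurable_fun setT phi -> measurable_fun setT psi ->
  (forall B, measurable B -> pi (phi @^-1` B) = mu B) ->
  (forall B, measurable B -> pi (psi @^-1` B) = nu B) ->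
  norm_measurable f -> norm_measurable g ->
  measurable_fun setT (fun z => `|f (phi z) - g (psi z)|) ->
  bochner_integrable mu f -> bochner_integrable nu g ->
  (`|bochner_integral mu f - bochner_integral nu g|%:E <=
   \int[pi]_z `|f (phi z) - g (psi z)|%:E)%E.
Proof.
move=> mphi mpsi phi_mu psi_nu mf mg mfg fi gi.
have [s fs sI] := bochner_integral_approx mf fi.
have [t gt tJ] := bochner_integral_approx mg gi.
set I := bochner_integral mu f in sI *; set J := bochner_integral nu g in tJ *.
apply/lee_addgt0Pr => e e0; have e4 : 0 < e / 4 by rewrite divr_gt0.
have [_ _ s0] := fs; have [_ _ t0] := gt.
have [N1 N1P] := cvge0_lt s0 e4; have [N2 N2P] := cvge0_lt t0 e4.
have /cvgrPdist_lt /(_ _ e4)[N3 _ N3P] := sI.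
have /cvgrPdist_lt /(_ _ e4)[N4 _ N4P] := tJ.
pose n := (N1 + N2 + N3 + N4)%N.
have n1 := N1P n ltac:(rewrite /n; lia); have n2 := N2P n ltac:(rewrite /n; lia).
have n3 := N3P n ltac:(rewrite /= /n; lia); have n4 := N4P n ltac:(rewrite /= /n; lia).
have IJ : `|I - J| <= `|I - simple_integral mu (s n)| +
    `|simple_integral mu (s n) - simple_integral nu (t n)| +
    `|J - simple_integral nu (t n)|.
  rewrite [`|J - _|]distrC.
  have -> : I - J = (I - simple_integral mu (s n)) +
    (simple_integral mu (s n) - simple_integral nu (t n)) +
    (simple_integral nu (t n) - J) by rewrite !subrKA.
  by rewrite (le_trans (ler_normD _ _))// lerD// ler_normD.
have D := bochner_dist n n mphi mpsi phi_mu psi_nu mf mg mfg fs gt.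
have IJ2 : `|I - J| <= e / 2 + `|simple_integral mu (s n) - simple_integral nu (t n)|.
  by move: n3 n4 => /=; lra.
move: IJ2; rewrite -lee_fin EFinD => /le_trans; apply.
apply: (le_trans (leeD (lexx _) D)).
have : (0 <= \int[pi]_z `|f (phi z) - g (psi z)|%:E)%E.
  by apply: integral_ge0 => z _; rewrite lee_fin.
move: (integral _ _ _) => M M0.
apply: (le_trans (leeD (lexx _) (leeD (leeD (ltW n1) (lexx M)) (ltW n2)))).
case: M M0 => [M _|_|//]; last by rewrite addye// leey.
by rewrite -!EFinD lee_fin; lra.
Qed.

End BochnerIntegral.

Section Approximation.
Context {R : realType} {V : normedModType R}.
Context {d : measure_display} {T : measurableType d}.
Context (mu : {finite_measure set T -> \bar R}) (f : T -> V) (w : nat -> V).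

(* Keeping [0] among the candidates makes [|f|] dominate [|f - greedy n|]. *)
Fixpoint greedy (n : nat) (x : T) : V :=
  if n is k.+1 then
    if `|f x - w k| < `|f x - greedy k x| then w k else greedy k x
  else 0.

Lemma greedy_le n x : `|f x - greedy n x| <= `|f x|.
Proof.
elim: n => [|n IH] /=; first by rewrite subr0.
by case: ifP => // /ltW /le_trans; apply.
Qed.

Lemma greedy_best k n x : (k < n)%N -> `|f x - greedy n x| <= `|f x - w k|.
Proof.
elim: n => // n IH; rewrite ltnS leq_eqVlt => /predU1P[<-|/IH kn] /=.
  by case: ifP => // /negbT; rewrite -leNgt.
by case: ifP => // /ltW /le_trans; apply.
Qed.

Hypothesis mf : norm_measurable f.

Lemma greedy_simple n : simple_fun (greedy n).
Proof.
elim: n => [|n [IHf IHm]] /=.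
  split; first by apply: (sub_finite_set _ (finite_set1 (0 : V))) => _ [x _ <-].
  by move=> v; rewrite preimage_cst; case: ifP.
pose B := [set x | `|f x - w n| < `|f x - greedy n x|].
have mB : measurable B.
  have mg : measurable_fun setT (fun x => `|f x - greedy n x|).
    exact: measurable_dist_simple.
  have /(_ measurableT [set true] I) := measurable_fun_ltr (mf (w n)) mg.
  by rewrite setTI.
split.
  apply: (sub_finite_set _ (_ : finite_set (range (greedy n) `|` [set w n]))).
    by move=> _ [x _ <-]; case: ifP => _; [right|left; exists x].
  by rewrite finite_setU; split => //; exact: finite_set1.
move=> v; rewrite (_ : _ @^-1` _ =
    (B `&` [set x | w n = v]) `|` (~` B `&` greedy n @^-1` [set v])); last first.
  apply/seteqP; split=> x /=; rewrite /B /=.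
    by case: ifP => [wx <-|/negbT/negP nwx gv]; [left|right].
  by case=> -[]; case: ifP.
apply: measurableU; apply: measurableI => //; last exact: measurableC.
have [->|wv] := pselect (w n = v).
  by rewrite (_ : [set x | _] = setT)//; apply/seteqP; split.
by rewrite (_ : [set x | _] = set0)//; apply/seteqP; split.
Qed.

Hypothesis w_dense :
  {ae mu, forall x, forall e : R, 0 < e -> exists n, `|f x - w n| < e}.

Lemma bochner_integrable_dense : (\int[mu]_x `|f x|%:E < +oo)%E ->
  bochner_integrable mu f.
Proof.
move=> fi; exists greedy.
have cv : {ae mu, forall x, greedy n x @[n --> \oo] --> f x}.
  apply: filterS w_dense => x wx; apply/cvgrPdist_lt => e /wx[k fk].
  by exists k.+1 => // n /= kn; rewrite (le_lt_trans (greedy_best x kn)).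
have mf0 : measurable_fun setT (fun x => `|f x|).
  by have := mf 0; under eq_fun do rewrite subr0.
have mfg n : measurable_fun setT (fun x => `|f x - greedy n x|%:E).
  by apply/measurable_EFinP/measurable_dist_simple => //; exact: greedy_simple.
split=> //; first exact: greedy_simple.
have [||||_ _ ] := @dominated_convergence _ T R mu setT measurableT
  (fun n x => `|f x - greedy n x|%:E) (cst 0%E) (fun x => `|f x|%:E) mfg.
- exact: measurable_cst.
- apply: filterS cv => x gx _; apply/fine_cvgP; split; first exact: nearW.
  apply/cvgrPdist_lt => e e0; have /cvgrPdist_lt /(_ _ e0) := gx.
  by apply: filterS => n; rewrite /= sub0r normrN normr_id.
- apply/integrableP; split; first exact/measurable_EFinP.
  by under eq_integral do rewrite /= normr_id.
- by apply: nearW => x n _; rewrite /= normr_id lee_fin greedy_le.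
by rewrite integral0.
Qed.

End Approximation.

(** * Borel measures on metric spaces *)

Lemma continuous_borel_measurable (R : realType) (Y : ptopologicalType)
    (F : Y -> R) :
  continuous F -> measurable_fun setT (F : borel Y -> R).
Proof.
move=> /continuousP cF; apply: (measurability _ (RGenOpens.measurableE R)).
move=> _ [_ [a [b ->] <-]]; rewrite setTI; apply: sub_sigma_algebra.
exact/cF/interval_open.
Qed.

Lemma open_borel_measurable (Y : ptopologicalType) (U : set Y) :
  open U -> measurable (U : set (borel Y)).
Proof. by move=> oU; exact: sub_sigma_algebra. Qed.

Lemma continuous_borel_measurable_fun (Y X : ptopologicalType) (F : Y -> X) :
  continuous F -> measurable_fun setT (F : borel Y -> borel X).
Proof.
move=> /continuousP cF; apply: measurability; first by [].
move=> _ [U oU <-]; rewrite setTI; apply: sub_sigma_algebra; exact: cF.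
Qed.

Section MetrizedBorel.
Context {R : realType} {X : pointedType} (d : X -> X -> \bar R) (dr : X -> X -> R).
Hypothesis dE : forall x y, d x y = (dr x y)%:E.
Hypothesis d_refl : forall x, dr x x = 0.
Hypothesis d_sym : forall x y, dr x y = dr y x.
Hypothesis d_tri : forall x y z, dr x z <= dr x y + dr y z.
Implicit Types (x y z : X) (e : R).

(** A set is open in [metrized d] when it contains a ball around each of its points; the triangle
    inequality is what places the balls themselves among these sets. *)
Lemma open_metrized_ball x e : open ([set y | dr x y < e] : set (metrized d)).
Proof.
move=> y /= xy; exists (e - dr x y); first by rewrite subr_gt0.
by move=> z; rewrite dE lte_fin ltrBrDl => /(le_lt_trans (d_tri x y z)).
Qed.

Lemma nbhs_metrized_ball x e : 0 < e ->
  nbhs (x : metrized d) [set y | dr x y < e].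
Proof.
by move=> e0; apply: open_nbhs_nbhs; split; [exact: open_metrized_ball|rewrite /= d_refl].
Qed.

Lemma metrized_continuous (V : normedModType R) (F : X -> V) :
  (forall x e, 0 < e -> exists2 r : R, 0 < r & forall y, dr x y < r -> `|F y - F x| <= e) ->
  continuous (F : metrized d -> V).
Proof.
move=> Fc x; have FF : Filter (nbhs (x : metrized d)) by exact: nbhs_filter.
apply/cvgrPdist_le => e e0; have [r r0 rF] := Fc x _ e0.
apply: (@filterS _ (nbhs (x : metrized d)) _ _ _ _ (nbhs_metrized_ball x r0)) => y /= /rF.
by rewrite distrC.
Qed.

Lemma metric_quadrilateral x y x' y' :
  `|dr x y - dr x' y'| <= dr x x' + dr y y'.
Proof.
have h1 := d_tri x x' y; have h2 := d_tri x' y' y.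
have h3 := d_tri x' x y'; have h4 := d_tri x y y'.
rewrite [dr y' y]d_sym in h2; rewrite [dr x' x]d_sym in h3.
by rewrite ler_norml; apply/andP; split; lra.
Qed.

Lemma metric_ge0 x y : 0 <= dr x y.
Proof. by have := d_tri x y x; rewrite d_refl [dr y x]d_sym; lra. Qed.

Lemma lipschitz_borel_measurable (C : R) (F : X -> R) : 0 < C ->
  (forall x y, `|F y - F x| <= C * dr x y) ->
  measurable_fun setT (F : borel (metrized d) -> R).
Proof.
move=> C0 FC; apply: continuous_borel_measurable.
apply: (@metrized_continuous R^o) => x e e0; exists (e / C); first by rewrite divr_gt0.
by move=> y /ltW xy; rewrite (le_trans (FC x y))// mulrC -ler_pdivlMr.
Qed.

Lemma metric_borel_measurable x :
  measurable_fun setT (dr x : borel (metrized d) -> R).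
Proof.
apply: (@lipschitz_borel_measurable 1) => // y z.
by rewrite mul1r (le_trans (metric_quadrilateral _ _ _ _))// d_refl add0r d_sym.
Qed.

Context (mu : probability (borel (metrized d)) R).

Lemma open_msupportC : open (~` msupport mu).
Proof.
rewrite openE => x /= /existsNP[U /not_implyP[[oU Ux] U0]].
have nU : nbhs (x : metrized d) U by exact: open_nbhs_nbhs.
apply: (@filterS _ (nbhs (x : metrized d)) _ U _ _ nU) => y Uy.
by move=> /(_ U (conj oU Uy)).
Qed.

(* A finite union of [r]-balls of almost maximal measure must meet the [r]-ball
   around any given point of the support. *)
Lemma dense_msupport : exists a : nat -> X,
  forall x, msupport mu x -> forall e, 0 < e -> exists n, dr x (a n) < e.
Proof.
pose B (e : R) (l : seq X) := \big[setU/set0]_(a <- l) [set y | dr a y < e].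
have mB e l : measurable (B e l : set (borel (metrized d))).
  by apply: bigsetU_measurable => a _; apply: open_borel_measurable; exact: open_metrized_ball.
pose m e l := fine (mu (B e l)).
have mE e l : mu (B e l) = (m e l)%:E by rewrite fineK// fin_num_measure.
have m1 e : has_sup (range (m e)).
  split; first by exists (m e [::]), [::].
  by exists 1 => _ [l _ <-]; rewrite -lee_fin -mE probability_le1.
(* [k.1] sets the radius of the balls, and [k.2] how close the measure of their union comes to its
   supremum over all finite unions. *)
have near_sup (k : nat * nat) : exists l : seq X,
    sup (range (m k.1.+1%:R^-1)) - k.2.+1%:R^-1 < m k.1.+1%:R^-1 l.
  have [|_ [l _ <-] ml] := @sup_adherent _ (range (m k.1.+1%:R^-1)) k.2.+1%:R^-1 _ (m1 _).
    by rewrite invr_gt0.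
  by exists l.
have [l lP] := choice near_sup.
have cover x e : msupport mu x -> 0 < e -> exists k, exists2 a, a \in l k & dr x a < e.
  move=> Sx e0; pose n := Num.truncn (2 / e); pose r : R := n.+1%:R^-1.
  have r0 : 0 < r by rewrite invr_gt0.
  have re : r + r <= e.
    have : 2 / e < n.+1%:R by exact: truncnS_gt.
    rewrite ltr_pdivrMr// -ltr_pdivrMl// => /ltW.
    by rewrite mulrDr mulr1.
  (* If every centre were at distance at least [e >= 2 r] from [x], the [r]-ball at [x] would miss
     the union whose defect is below the measure of that ball, and adding it would exceed the
     supremum. *)
  apply: contrapT => nk.
  pose U := [set y | dr x y < r].
  have U0 : (0 < mu U)%E.
    by apply: Sx; split; [exact: open_metrized_ball|rewrite /U /= d_refl].
  have Ufin : mu U \is a fin_num.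
    apply: fin_num_measure; apply: open_borel_measurable; exact: open_metrized_ball.
  have u0 : 0 < fine (mu U) by rewrite fine_gt0// U0 ltey_eq Ufin.
  pose j := Num.truncn (fine (mu U))^-1.
  have uj : (j.+1%:R : R)^-1 < fine (mu U).
    by rewrite invf_plt ?posrE//; exact: truncnS_gt.
  have := lP (n, j); rewrite /= -/r => lj.
  have UB : U `&` B r (l (n, j)) = set0.
    rewrite -subset0 => y [/= xy]; rewrite /B -bigcup_seq => -[a /= al ay].
    apply: nk; exists (n, j); exists a => //.
    by rewrite (le_lt_trans (d_tri x y a))// (lt_le_trans _ re)// ltrD// d_sym.
  have : m r (x :: l (n, j)) = fine (mu U) + m r (l (n, j)).
    apply: EFin_inj; rewrite EFinD (fineK Ufin) -(mE r (x :: _)) -(mE r (l _)).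
    rewrite {1}/B big_cons measureU//; last exact: mB.
    by apply: open_borel_measurable; exact: open_metrized_ball.
  have : m r (x :: l (n, j)) <= sup (range (m r)).
    by apply: sup_upper_bound; [exact: m1|exists (x :: l (n, j))].
  move: uj lj; move: (m r (x :: _)) (m r (l _)) (fine _) (sup _) (j.+1%:R^-1) => p q u s i.
  lra.
exists (fun i => if (unpickle i : option (nat * nat * nat)) is Some (k, j)
  then nth point (l k) j else point).
move=> x Sx e e0; have [k [a al xa]] := cover _ _ Sx e0.
by exists (pickle (k, index a (l k))); rewrite pickleK nth_index.
Qed.

Lemma metric_integral_lty x y :
  (\int[mu]_z (dr y z)%:E < +oo)%E -> (\int[mu]_z (dr x z)%:E < +oo)%E.
Proof.
move=> yi; have md z : measurable_fun setT (fun a : borel (metrized d) => (dr z a)%:E).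
  by apply/measurable_EFinP; exact: metric_borel_measurable.
apply: (@le_lt_trans _ _ (\int[mu]_z ((dr x y)%:E + (dr y z)%:E))%E).
  apply: ge0_le_integral => //.
  - by move=> z _; rewrite lee_fin metric_ge0.
  - exact: emeasurable_funD.
  - by move=> z _; rewrite -EFinD lee_fin d_tri.
rewrite ge0_integralD//.
- by rewrite integral_cst//= probability_setT mule1 lte_add_pinfty ?ltry.
- by move=> z _; rewrite lee_fin metric_ge0.
- by move=> z _; rewrite lee_fin metric_ge0.
Qed.

End MetrizedBorel.

(** * Continuity of the Karcher map *)

Lemma ler_dist_distB (R : realType) (V : normedModType R) (a b a' b' : V) :
  `| `|a - b| - `|a' - b'| | <= `|a - a'| + `|b - b'|.
Proof.
rewrite (le_trans (ler_dist_dist _ _))//.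
have -> : a - b - (a' - b') = (a - a') - (b - b').
  by rewrite !opprB [b' - a']addrC addrACA [- b + b']addrC.
exact: ler_normB.
Qed.

Section KarcherContinuity.
Context {R : realType} {A : cstarAlgType R}.
Implicit Types (x y a b : cone A) (mu nu : prob1 (thompson A)) (e : R).

Lemma herm_complete (u : nat -> herm A) :
  (forall e : R, 0 < e -> exists N : nat, forall m n : nat,
      (N <= m)%N -> (N <= n)%N -> `|u m - u n| < e) -> cvgn u.
Proof.
move=> uc; have [l ul] := cnorm_complete (fun n => u n : A) uc.
have lh : l \in is_herm A.
  rewrite unfold_in; apply/eqP/eqP; rewrite -subr_eq0; apply/eqP/cnorm_small => e e0.
  have [|N /(_ N (leqnn N)) uN] := ul (e / 2); first by rewrite divr_gt0.
  rewrite (le_trans (cnorm_tri _ (u N : A) _))// (splitr e) lerD//.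
    by rewrite -{1}(herm_star (u N)) -starB cnorm_star_eq cnormB ltW.
  exact: ltW.
apply/cvg_ex; exists (Herm lh); apply/cvgrPdist_lt => e e0.
have [N NP] := ul e e0; exists N => // n /NP; rewrite distrC.
by [].
Qed.

Local Notation MX := (metrized (thompson A)).

Let borel_lipschitz := @lipschitz_borel_measurable _ _ _ _ (@thompsonE R A)
  thompson_refl thompson_tri.

Lemma log_at_norm_measurable x : norm_measurable (log_at x : borel MX -> herm A).
Proof.
move=> v; apply: (@borel_lipschitz 1) => // a b.
rewrite mul1r (le_trans (ler_dist_dist _ _))// opprB addrA subrK distrC.
exact: log_at_dist.
Qed.

Lemma thompsonR_measurable x : measurable_fun setT (thompsonR x : borel MX -> R).
Proof.
exact: (metric_borel_measurable thompsonE thompson_refl thompson_sym thompson_tri).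
Qed.

Lemma integral_thompson_lty x mu : (\int[mu]_a (thompsonR x a)%:E < +oo)%E.
Proof.
have := prob1_valP mu; rewrite unfold_in => /asboolP[_ [y]].
under eq_integral do rewrite thompsonE thompson_sym.
exact: (metric_integral_lty thompsonE thompson_refl thompson_sym thompson_tri).
Qed.

Lemma log_at_bochner_integrable x mu : bochner_integrable mu (log_at x).
Proof.
have [a aP] := dense_msupport thompsonE thompson_refl thompson_sym thompson_tri mu.
have := prob1_valP mu; rewrite unfold_in => /asboolP[S1 _].
apply: (@bochner_integrable_dense _ _ _ _ mu _ (fun n => log_at x (a n))).
- exact: log_at_norm_measurable.
- have mS : measurable (~` msupport mu : set (borel MX)).
    by apply: open_borel_measurable; exact: open_msupportC.
  exists (~` msupport mu); split => //.
    have mS' : measurable (msupport mu : set (borel MX)).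
      by rewrite -[msupport mu]setCK; exact: measurableC.
    rewrite /full_support in S1.
    by apply: etrans (probability_setC mu mS') _; rewrite S1 subee.
  move=> b nb Sb; apply: nb => e e0; have [n ban] := aP b Sb e e0.
  by exists n; rewrite (le_lt_trans (log_at_dist _ _ _)).
- apply: le_lt_trans (integral_thompson_lty x mu); apply: ge0_le_integral => //.
  + apply/measurable_EFinP; have := log_at_norm_measurable x 0.
    by under eq_fun do rewrite subr0.
  + by apply/measurable_EFinP; exact: thompsonR_measurable.
  + by move=> b _; rewrite lee_fin log_at_norm.
Qed.

Lemma log_at_dist_measurable x y :
  measurable_fun setT ((fun a => `|log_at y a - log_at x a|) : borel MX -> R).
Proof.
apply: (@borel_lipschitz 2) => // a b.
rewrite (le_trans (ler_dist_distB _ _ _ _))// mulr_natl mulr2n thompson_sym.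
by rewrite lerD ?log_at_dist.
Qed.

Lemma karcher_dist x y mu : (`|karcher_map y mu - karcher_map x mu|%:E <=
  \int[mu]_a `|log_at y a - log_at x a|%:E)%E.
Proof.
apply: (@bochner_integral_dist _ _ herm_complete _ _ _ _ _ _ mu mu mu id id) => //.
- exact: log_at_norm_measurable.
- exact: log_at_norm_measurable.
- exact: log_at_dist_measurable.
- exact: log_at_bochner_integrable.
- exact: log_at_bochner_integrable.
Qed.

(** Dominated convergence is sequential, so a failure of continuity is first turned into a sequence
    [y n] within [1 / (n + 1)] of [x]. *)
Lemma karcher_continuousl x mu e : 0 < e ->
  exists2 r : R, 0 < r & forall y, thompsonR x y < r ->
    `|karcher_map y mu - karcher_map x mu| <= e.
Proof.
move=> e0; apply: contrapT => nr.
have /choice[y yP] : forall n : nat, exists y, thompsonR x y < n.+1%:R^-1 /\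
    e < `|karcher_map y mu - karcher_map x mu|.
  move=> n; apply: contrapT => ny; apply: nr; exists n.+1%:R^-1.
    by rewrite invr_gt0.
  by move=> y xy; rewrite leNgt; apply/negP => ey; apply: ny; exists y.
pose F n (a : borel MX) := `|log_at (y n) a - log_at x a|%:E.
have Fm n : measurable_fun setT (F n).
  by apply/measurable_EFinP; exact: log_at_dist_measurable.
(* The two logarithms are bounded by the distances from [a] to their base points, and [y n] is
   within 1 of [x]; the bound is integrable because [mu] has a finite first moment. *)
have F0le n a : `|log_at (y n) a - log_at x a| <= 2 * thompsonR x a + 1.
  rewrite (le_trans (ler_normB _ _))//.
  rewrite (le_trans (lerD (log_at_norm (y n) a) (log_at_norm x a)))//.
  have yn : thompsonR (y n) a <= 1 + thompsonR x a.
    rewrite (le_trans (thompson_tri _ x _))// lerD2r thompson_sym.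
    by rewrite (le_trans (ltW (yP n).1))// invf_le1 ?ler1n.
  by move: (thompsonR (y n) a) (thompsonR x a) yn => p q; lra.
have F0 : (\int[mu]_a F n a @[n --> \oo] --> 0)%E.
  have [||||_ _ ] := @dominated_convergence _ _ R mu setT measurableT
    F (cst 0%E) (fun a => (2 * thompsonR x a + 1)%:E) Fm.
  - exact: measurable_cst.
  - apply: nearW => a _; apply/fine_cvgP; split; first exact: nearW.
    apply/cvgrPdist_le => e' e'0; have [r r0 rP] := log_at_cont x a e'0.
    have [N NP] := natSinv_lt r0; exists N => // n /NP nr'.
    rewrite /F /= sub0r normrN normr_id; apply: rP.
    exact: lt_trans (yP n).1 nr'.
  - apply/integrableP; split.
      apply/measurable_EFinP; apply: measurable_funD => //.
      by apply: measurable_funM => //; exact: thompsonR_measurable.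
    have m2 : measurable_fun setT (fun a : borel MX => (thompsonR x a)%:E).
      by apply/measurable_EFinP; exact: thompsonR_measurable.
    have -> : (\int[mu]_a `|(2 * thompsonR x a + 1)%:E| =
        2%:E * \int[mu]_a (thompsonR x a)%:E + 1)%E.
      transitivity (\int[mu]_a (2%:E * (thompsonR x a)%:E + 1))%E.
        apply: eq_integral => a _; rewrite gee0_abs ?EFinD ?EFinM// lee_fin.
        by rewrite addr_ge0// mulr_ge0// thompson_ge0.
      have g0 (a : borel MX) : (0 <= (thompsonR x a)%:E)%E.
        by rewrite lee_fin thompson_ge0.
      rewrite ge0_integralD//.
      + by rewrite ge0_integralZl_EFin// integral_cst//= probability_setT mule1.
      + by move=> a _; rewrite mule_ge0.
      + exact: measurable_funeM.
    by rewrite lte_add_pinfty ?ltry// lte_mul_pinfty// integral_thompson_lty.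
  - by apply: nearW => a n _; rewrite /F /= normr_id lee_fin.
  by rewrite integral0.
have [N /(_ N (leqnn N))] := cvge0_lt F0 e0.
rewrite ltNge => /negP; apply; apply: le_trans (karcher_dist _ _ _).
by rewrite lee_fin ltW//; case: (yP N).
Qed.

Lemma karcher_wasserstein x mu nu : (`|karcher_map x mu - karcher_map x nu|%:E <=
  wasserstein (thompson A) mu nu)%E.
Proof.
apply: le_ereal_inf_tmp => _ [pi [_ pi1 pi2] <-].
(* A function of two variables with this Lipschitz bound is continuous for the product topology,
   hence measurable for the Borel sets on which couplings live. *)
have prod_cont (G : cone A -> cone A -> R) :
    (forall a b a' b', `|G a b - G a' b'| <= thompsonR a a' + thompsonR b b') ->
    measurable_fun setT ((fun z => G z.1 z.2) : borel (MX * MX)%type -> R).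
  move=> GL; apply: continuous_borel_measurable => -[a b].
  have FF : Filter (nbhs ((a, b) : MX * MX)) by exact: nbhs_filter.
  apply/cvgrPdist_le => e e0; have e2 : 0 < e / 2 by rewrite divr_gt0.
  exists ([set a' | thompsonR a a' < e / 2], [set b' | thompsonR b b' < e / 2]).
    by split; apply: (nbhs_metrized_ball thompsonE thompson_refl thompson_tri).
  move=> [a' b'] [/= ha hb]; rewrite (le_trans (GL _ _ _ _))// (splitr e).
  by rewrite ltW// ltrD.
have mfst : measurable_fun setT (fst : borel (MX * MX)%type -> borel MX).
  by apply: continuous_borel_measurable_fun => z; exact: cvg_fst.
have msnd : measurable_fun setT (snd : borel (MX * MX)%type -> borel MX).
  by apply: continuous_borel_measurable_fun => z; exact: cvg_snd.
have mlog : measurable_fun setT ((fun z => `|log_at x z.1 - log_at x z.2|) :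
    borel (MX * MX)%type -> R).
  apply: (prod_cont (fun a b => `|log_at x a - log_at x b|)) => a b a' b'.
  by rewrite (le_trans (ler_dist_distB _ _ _ _))// lerD ?log_at_dist.
have mthompson : measurable_fun setT ((fun z => thompsonR z.1 z.2) :
    borel (MX * MX)%type -> R).
  by apply: (prod_cont thompsonR) => a b a' b'; exact: (metric_quadrilateral thompson_sym thompson_tri).
apply: le_trans (bochner_integral_dist herm_complete mfst msnd pi1 pi2
  (log_at_norm_measurable x) (log_at_norm_measurable x) mlog
  (log_at_bochner_integrable x mu) (log_at_bochner_integrable x nu)) _.
apply: ge0_le_integral => //.
- exact/measurable_EFinP.
- exact/measurable_EFinP.
- by move=> z _; rewrite lee_fin log_at_dist.
Qed.

End KarcherContinuity.

(** Since [bochner_integral] has a default value, the first conjunct certifies that the map in the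
    second one is given by genuine integrals. *)
Theorem lemma4p2 (R : realType) (A : cstarAlgType R) :
  (forall (x : cone A) (mu : prob1 (thompson A)),
     bochner_integrable mu (log_at x)) /\
  continuous (fun p : metrized (thompson A) *
                      metrized (wasserstein (thompson A)) =>
                karcher_map p.1 p.2).
Proof.
split=> [x mu|[x mu]]; first exact: log_at_bochner_integrable.
have FF : Filter (nbhs ((x, mu) : metrized (thompson A) *
  metrized (wasserstein (thompson A)))) by exact: nbhs_filter.
apply/cvgrPdist_le => e e0; have e2 : 0 < e / 2 by rewrite divr_gt0.
have [r r0 rP] := karcher_continuousl x mu e2.
(* [V] is open because each [karcher_map y] is 1-Lipschitz; this avoids the
   triangle inequality of the Wasserstein distance, hence the gluing of
   couplings. *)
pose V := [set nu : metrized (wasserstein (thompson A)) |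
  exists2 e' : R, e' < e / 2 & forall y, `|karcher_map y mu - karcher_map y nu| <= e'].
have Vmu : nbhs (mu : metrized (wasserstein (thompson A))) V.
  apply: open_nbhs_nbhs; split; last first.
    by exists 0 => // y; rewrite subrr normr0.
  (* The strict inequality [e' < e / 2] leaves room: half of the gap is spent on moving [nu], and
     the new bound [e' + k] is still below [e / 2]. *)
  move=> nu [e' e'e nuP]; pose k := (e / 2 - e') / 2.
  have k0 : 0 < k by rewrite divr_gt0// subr_gt0.
  exists k => // nu' Wk; exists (e' + k) => [|y]; first by rewrite /k; lra.
  have : `|karcher_map y nu - karcher_map y nu'| < k.
    by rewrite -lte_fin (le_lt_trans (karcher_wasserstein _ _ _)).
  by have := ler_distD (karcher_map y nu) (karcher_map y mu) (karcher_map y nu');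
    have := nuP y; lra.
exists ([set y | thompsonR x y < r], V).
  by split=> //; apply: (nbhs_metrized_ball thompsonE thompson_refl thompson_tri).
move=> [y nu] [/= xy [e' e'e nuP]].
(* The base point is moved at the fixed measure [mu], and the measure is moved at [y], which is
   possible because the bound in [V] holds for all base points at once. *)
apply: le_trans (ler_distD (karcher_map y mu) _ _) _; rewrite [leRHS]splitr lerD//.
  by rewrite distrC rP.
by rewrite (le_trans (nuP y))// ltW.
Qed.
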